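(* Let $X\in\mathbb{R}^D$ be a sub-Gaussian random vector with covariance $\Sigma$, let $X_1,\dots,X_N$ be independent copies of $X$ and $\hat\Sigma$ the sample covariance. Let $A\in\mathbb{R}^{d_1\times D}$, $B\in\mathbb{R}^{d_2\times D}$. There exists a universal constant $C>0$ such that for any $u>0$, if $N>C(\operatorname{rank}(\Sigma)+u)\|\sqrt{\Sigma^\dagger}\tilde X\|_{\psi_2}^4$, then with probability at least $1-\exp(-u)$, $$\|A(\hat\Sigma^\dagger-\Sigma^\dagger)B^\top\|_2\lesssim \|A\Sigma^\dagger\tilde X\|_{\psi_2}\|B\Sigma^\dagger\tilde X\|_{\psi_2}\sqrt{\frac{\operatorname{rank}(\Sigma)+u}{N}}.$$
   Context: $\tilde X:=X-\mathbb{E}X$, $\Sigma=\mathbb{E}\tilde X\tilde X^\top$, $\hat\mu_X:=N^{-1}\sum_iX_i$, $\hat\Sigma:=N^{-1}\sum_i(X_i-\hat\mu_X)(X_i-\hat\mu_X)^\top$. $M^\dagger$ is the Moore–Penrose pseudoinverse and $\sqrt{\Sigma^\dagger}$ the positive semidefinite square root of $\Sigma^\dagger$. $\|Z\|_{\psi_2}:=\inf\{s>0:\mathbb{E}\exp(|Z/s|^2)\le2\}$ for real $Z$ and $\sup_{\|v\|_2=1}\|v^\top Z\|_{\psi_2}$ for random vectors. $\|\cdot\|_2$ is the spectral norm. $a\lesssim b$ means $a\le C'b$ for a universal constant $C'>0$. *)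

(* Defs.v *)
(* MathComp + MathComp-Analysis, over Stdlib's concrete reals R
   (a realType via Rstruct), so that "universal constants" are real numbers
   chosen before everything else. *)
From HB Require Import structures.
From mathcomp Require Import all_boot all_order all_algebra.
From mathcomp Require Import all_classical all_reals all_analysis.
From mathcomp Require Import Rstruct Rstruct_topology.
From Stdlib Require Import Rdefinitions.
Set Implicit Arguments. Unset Strict Implicit. Unset Printing Implicit Defensive.
Import Order.TTheory GRing.Theory Num.Theory.
Local Open Scope classical_set_scope.
Local Open Scope ring_scope.

Definition RR : realType := Rdefinitions.R.

Section Defs.
Context {d : measure_display} {T : measurableType d} (P : probability T RR).

(* real-valued expectation (meaningful for integrable variables) *)
Definition Ex (f : T -> RR) : RR := fine (\int[P]_w (f w)%:E).

Definition mean_vec (n : nat) (X : T -> 'cV[RR]_n) : 'cV[RR]_n :=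
  \col_j Ex (fun w => X w j 0).

Definition centered (n : nat) (X : T -> 'cV[RR]_n) : T -> 'cV[RR]_n :=
  fun w => X w - mean_vec X.

Definition cov_mx (n : nat) (X : T -> 'cV[RR]_n) : 'M[RR]_n :=
  \matrix_(i, j) Ex (fun w => centered X w i 0 * centered X w j 0).

(* psi_2 Orlicz norm of a real random variable:
   inf { s > 0 : E exp(|Z/s|^2) <= 2 }  (= +oo if no such s) *)
Definition psi2 (Z : T -> RR) : \bar RR :=
  ereal_inf [set (s%:E) | s in
    [set s : RR | 0 < s /\ (\int[P]_w (expR ((`|Z w / s|) ^+ 2))%:E <= 2%:E)%E]].

Definition eucl_norm (n : nat) (v : 'cV[RR]_n) : RR :=
  Num.sqrt (\sum_i (v i 0) ^+ 2).

Definition psi2_vec (n : nat) (Z : T -> 'cV[RR]_n) : \bar RR :=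
  ereal_sup [set psi2 (fun w => (v^T *m Z w) 0 0) | v in
    [set v : 'cV[RR]_n | eucl_norm v = 1]].

Definition rvec_measurable (n : nat) (X : T -> 'cV[RR]_n) : Prop :=
  forall j : 'I_n, measurable_fun setT (fun w => X w j 0).

(* equality in law, tested on Borel rectangles (a generating pi-system) *)
Definition same_law (n : nat) (X Y : T -> 'cV[RR]_n) : Prop :=
  forall Bs : 'I_n -> set RR, (forall j, measurable (Bs j)) ->
    P [set w | forall j, Bs j (X w j 0)] = P [set w | forall j, Bs j (Y w j 0)].

(* mutual independence of a finite family of random vectors (product rule
   on rectangles; taking some rectangles = whole space gives subfamilies) *)
Definition mutually_independent (N n : nat) (Xs : 'I_N -> T -> 'cV[RR]_n) : Prop :=
  forall Bs : 'I_N -> 'I_n -> set RR, (forall i j, measurable (Bs i j)) ->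
    P [set w | forall i j, Bs i j (Xs i w j 0)] =
    \big[*%E/1%E]_(i < N) P [set w | forall j, Bs i j (Xs i w j 0)].

End Defs.

Definition sample_mean (N n : nat) (xs : 'I_N -> 'cV[RR]_n) : 'cV[RR]_n :=
  (N%:R)^-1 *: \sum_(i < N) xs i.

Definition sample_cov (N n : nat) (xs : 'I_N -> 'cV[RR]_n) : 'M[RR]_n :=
  (N%:R)^-1 *: \sum_(i < N)
     ((xs i - sample_mean xs) *m (xs i - sample_mean xs)^T).

(* Moore--Penrose pseudoinverse, defined by the four Penrose conditions
   (real matrices: conjugate transpose = transpose). *)
Definition is_pinv (m n : nat) (M : 'M[RR]_(m, n)) (Q : 'M[RR]_(n, m)) : Prop :=
  [/\ M *m Q *m M = M, Q *m M *m Q = Q, (M *m Q)^T = M *m Q & (Q *m M)^T = Q *m M].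

Definition mp_pinv (m n : nat) (M : 'M[RR]_(m, n)) : 'M[RR]_(n, m) :=
  xget 0 [set Q | is_pinv M Q].

Definition psd (n : nat) (S : 'M[RR]_n) : Prop :=
  S^T = S /\ forall v : 'cV[RR]_n, 0 <= (v^T *m S *m v) 0 0.

Definition psd_sqrt (n : nat) (M : 'M[RR]_n) : 'M[RR]_n :=
  xget 0 [set S | psd S /\ S *m S = M].

Definition spec_norm (m n : nat) (M : 'M[RR]_(m, n)) : RR :=
  sup [set eucl_norm (M *m v) | v in [set v : 'cV[RR]_n | eucl_norm v = 1]].

(* Main.v *)
(** Write Pi for the orthogonal projector on the range of Sigma, S for the square
    root of the pseudoinverse of Sigma, and H for the difference between the sample
    covariance and Sigma. Almost surely the sample covariance is supported on the
    range of Sigma, and as soon as |S H S| <= 1/2 it is invertible there, with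
      Sigmahat^+ - Sigma^+ = - Sigma^+ H Sigma^+ + (Sigma^+ H S) W (S H Sigma^+), |W| <= 2.
    So it suffices to bound |M1 H M2^T| for M1, M2 among A Sigma^+, B Sigma^+ and S.
    All these matrices have rank at most r = rank Sigma: factoring out isometries
    reduces each bound to bilinear forms on nets of size 2^(18 r) of balls of dimension
    at most r, and each value of the bilinear form is controlled by Bernstein's
    inequality, products of sub-Gaussian variables being sub-exponential. The condition
    on N makes |S H S| <= 1/2 and absorbs the quadratic term into the linear one. *)
Require Import Defs.
From HB Require Import structures.
From mathcomp Require Import all_boot all_order all_algebra.
From mathcomp Require Import all_classical all_reals all_analysis.
From mathcomp Require Import Rstruct Rstruct_topology.
From mathcomp Require complex.
From mathcomp Require Import measurable_realfun ring lra.
Import Order.TTheory GRing.Theory Num.Theory.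
Local Open Scope classical_set_scope.
Local Open Scope ring_scope.
Set Implicit Arguments. Unset Strict Implicit. Unset Printing Implicit Defensive.

(** * Euclidean norms, operator bounds and pseudoinverses *)

Section Euclid.

(** The hypotheses come in a weak form that shapes the proof. Independence and equality in law are
    tested on rectangles only, so product formulas for exponential moments have to be extended to
    functions of whole vectors. A psi_2 norm is an infimum, so tail bounds are stated at a scale
    strictly above it: twice the norm serves when it is positive, and the case of norm 0 is treated
    apart. Events about pseudoinverses are never shown measurable; a measurable exceptional set is
    carried along instead. Bernstein's inequality gives the rate sqrt(t / N) only for t <= N. With t
    = 50 (r + u), the factor exp(- t) pays for all pairs of net points, and t <= N follows from the
    condition on N because the psi_2 norm K of the whitened vector is at least 1 when Sigma is
    nonzero. The fourth power of K appears because |S H S| is of order K^2 sqrt((r + u) / N) and has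
    to be at most 1/2. *)

Definition dot n (u v : 'cV[RR]_n) : RR := (u^T *m v) 0 0.

Lemma dotE n (u v : 'cV[RR]_n) : dot u v = \sum_i u i 0 * v i 0.
Proof. by rewrite /dot mxE; apply: eq_bigr => i _; rewrite mxE. Qed.

Lemma dotC n (u v : 'cV[RR]_n) : dot u v = dot v u.
Proof. by rewrite !dotE; apply: eq_bigr => i _; rewrite mulrC. Qed.

Lemma dotDr n (u v w : 'cV[RR]_n) : dot u (v + w) = dot u v + dot u w.
Proof. by rewrite /dot mulmxDr mxE. Qed.

Lemma dotZr n (u v : 'cV[RR]_n) a : dot u (a *: v) = a * dot u v.
Proof. by rewrite /dot -scalemxAr mxE. Qed.

Lemma dotDl n (u v w : 'cV[RR]_n) : dot (u + v) w = dot u w + dot v w.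
Proof. by rewrite dotC dotDr !(dotC w). Qed.

Lemma dotZl n (u v : 'cV[RR]_n) a : dot (a *: u) v = a * dot u v.
Proof. by rewrite dotC dotZr dotC. Qed.

Lemma dotNr n (u v : 'cV[RR]_n) : dot u (- v) = - dot u v.
Proof. by rewrite -scaleN1r dotZr mulN1r. Qed.

Lemma dot0r n (u : 'cV[RR]_n) : dot u 0 = 0.
Proof. by rewrite -(scale0r (0 : 'cV[RR]_n)) dotZr mul0r. Qed.

Lemma dot_mulr m n (u : 'cV[RR]_m) (M : 'M[RR]_(m, n)) v :
  dot u (M *m v) = dot (M^T *m u) v.
Proof. by rewrite /dot trmx_mul trmxK mulmxA. Qed.

Lemma eucl_norm_ge0 n (v : 'cV[RR]_n) : 0 <= eucl_norm v.
Proof. exact: sqrtr_ge0. Qed.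

Lemma eucl_norm_sqr n (v : 'cV[RR]_n) : eucl_norm v ^+ 2 = dot v v.
Proof.
rewrite sqr_sqrtr ?dotE; last by apply: sumr_ge0 => i _; exact: sqr_ge0.
by apply: eq_bigr => i _; rewrite expr2.
Qed.

Lemma eucl_norm0 n : eucl_norm (0 : 'cV[RR]_n) = 0.
Proof.
by rewrite /eucl_norm big1 ?sqrtr0// => i _; rewrite mxE expr0n.
Qed.

Lemma eucl_norm_eq0 n (v : 'cV[RR]_n) : eucl_norm v = 0 -> v = 0.
Proof.
move=> v0; have /eqP := eucl_norm_sqr v; rewrite v0 expr0n eq_sym dotE.
rewrite psumr_eq0; last by move=> i _; rewrite -expr2 sqr_ge0.
move=> /allP h; apply/colP => i; rewrite mxE; apply/eqP.
by have := h i (mem_index_enum _); rewrite -expr2 sqrf_eq0.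
Qed.

Lemma eucl_normZ n (v : 'cV[RR]_n) a : eucl_norm (a *: v) = `|a| * eucl_norm v.
Proof.
apply/eqP; rewrite -(eqrXn2 (n := 2))// ?mulr_ge0 ?eucl_norm_ge0//.
by rewrite eucl_norm_sqr exprMn eucl_norm_sqr real_normK ?num_real// dotZr dotZl mulrA.
Qed.

Lemma eucl_normN n (v : 'cV[RR]_n) : eucl_norm (- v) = eucl_norm v.
Proof. by rewrite -scaleN1r eucl_normZ normrN1 mul1r. Qed.

Lemma dot_le n (u v : 'cV[RR]_n) : dot u v <= eucl_norm u * eucl_norm v.
Proof.
have [u0|u0] := eqVneq (eucl_norm u) 0.
  by rewrite (eucl_norm_eq0 u0) dotC dot0r eucl_norm0 mul0r.
have [v0|v0] := eqVneq (eucl_norm v) 0.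
  by rewrite (eucl_norm_eq0 v0) dot0r eucl_norm0 mulr0.
set a := eucl_norm u in u0 *; set b := eucl_norm v in v0 *.
have a0 : 0 < a by rewrite lt_def u0 eucl_norm_ge0.
have b0 : 0 < b by rewrite lt_def v0 eucl_norm_ge0.
have := sqr_ge0 (eucl_norm (b *: u + (- a) *: v)).
rewrite eucl_norm_sqr !(dotDl, dotDr, dotZl, dotZr) -!eucl_norm_sqr.
rewrite -/a -/b (dotC v u) => h.
have : 0 <= (2 * (a * b)) * (a * b - dot u v) by nra.
by rewrite pmulr_rge0 ?subr_ge0// !mulr_gt0.
Qed.

Lemma eucl_normD n (u v : 'cV[RR]_n) : eucl_norm (u + v) <= eucl_norm u + eucl_norm v.
Proof.
rewrite -ler_sqr ?nnegrE ?addr_ge0 ?eucl_norm_ge0//.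
rewrite eucl_norm_sqr dotDl !dotDr -!eucl_norm_sqr (dotC v u) sqrrD.
by have := dot_le u v; lra.
Qed.

Lemma coord_le_eucl_norm n (v : 'cV[RR]_n) i : `|v i 0| <= eucl_norm v.
Proof.
rewrite -ler_sqr ?nnegrE ?eucl_norm_ge0// eucl_norm_sqr dotE.
rewrite (bigD1 i)//= real_normK ?num_real// expr2 lerDl.
by apply: sumr_ge0 => j _; rewrite -expr2 sqr_ge0.
Qed.

Lemma eucl_norm_tr_mul m n (U : 'M[RR]_(m, n)) v :
  U^T *m U = 1%:M -> eucl_norm (U *m v) = eucl_norm v.
Proof.
move=> UU; apply/eqP; rewrite -(eqrXn2 (n := 2))// ?eucl_norm_ge0//.
by rewrite !eucl_norm_sqr dot_mulr mulmxA UU mul1mx.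
Qed.

(** Used in place of [spec_norm]: such inequalities combine under sums and products without handling
    a supremum, also in dimension 0, where there is no unit vector. *)
Definition op_bound m n (M : 'M[RR]_(m, n)) c :=
  forall v, eucl_norm (M *m v) <= c * eucl_norm v.

Lemma op_bound_mul m n p (M : 'M[RR]_(m, n)) (L : 'M[RR]_(n, p)) a b :
  0 <= a -> op_bound M a -> op_bound L b -> op_bound (M *m L) (a * b).
Proof.
move=> a0 Ma Lb v; rewrite -mulmxA (le_trans (Ma _))// -mulrA ler_wpM2l//.
Qed.

Lemma op_boundD m n (M L : 'M[RR]_(m, n)) a b :
  op_bound M a -> op_bound L b -> op_bound (M + L) (a + b).
Proof.
move=> Ma Lb v; rewrite mulmxDl mulrDl (le_trans (eucl_normD _ _))// lerD//.
Qed.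

Lemma op_boundN m n (M : 'M[RR]_(m, n)) a : op_bound M a -> op_bound (- M) a.
Proof. by move=> Ma v; rewrite mulNmx eucl_normN. Qed.

Lemma op_bound_le m n (M : 'M[RR]_(m, n)) a b : a <= b -> op_bound M a -> op_bound M b.
Proof. by move=> ab Ma v; rewrite (le_trans (Ma v))// ler_wpM2r// eucl_norm_ge0. Qed.

Lemma op_boundT m n (M : 'M[RR]_(m, n)) a : 0 <= a -> op_bound M a -> op_bound M^T a.
Proof.
move=> a0 Ma v; set w := M^T *m v.
have [w0|w0] := eqVneq (eucl_norm w) 0.
  by rewrite w0 mulr_ge0 ?eucl_norm_ge0.
have {}w0 : 0 < eucl_norm w by rewrite lt_def w0 eucl_norm_ge0.
rewrite -(ler_pM2l w0) -expr2 eucl_norm_sqr /w dot_mulr trmxK -/w.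
rewrite (le_trans (dot_le _ _))//.
by have := Ma w; have := eucl_norm_ge0 v; nra.
Qed.

Lemma bilinear_op_bound m n (M : 'M[RR]_(m, n)) c : 0 <= c ->
  (forall x y, eucl_norm x <= 1 -> eucl_norm y <= 1 -> dot x (M *m y) <= c) ->
  op_bound M c.
Proof.
move=> c0 h v.
have [v0|v0] := eqVneq (eucl_norm v) 0.
  by rewrite (eucl_norm_eq0 v0) mulmx0 !eucl_norm0 mulr0.
have [w0|w0] := eqVneq (eucl_norm (M *m v)) 0.
  by rewrite w0 mulr_ge0 ?eucl_norm_ge0.
set a := eucl_norm v in v0 *; set b := eucl_norm (M *m v) in w0 *.
have a0 : 0 < a by rewrite lt_def v0 eucl_norm_ge0.
have b0 : 0 < b by rewrite lt_def w0 eucl_norm_ge0.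
have := h (b^-1 *: (M *m v)) (a^-1 *: v).
have -> : eucl_norm (b^-1 *: (M *m v)) = 1.
  by rewrite eucl_normZ ger0_norm ?invr_ge0 ?(ltW b0)// mulVf// lt0r_neq0.
have -> : eucl_norm (a^-1 *: v) = 1.
  by rewrite eucl_normZ ger0_norm ?invr_ge0 ?(ltW a0)// mulVf// lt0r_neq0.
rewrite lexx => /(_ erefl erefl).
rewrite -scalemxAr dotZl dotZr -eucl_norm_sqr -/b expr2 mulrCA mulKf//.
by rewrite ler_pdivrMl// mulrC.
Qed.

Lemma op_bound_exists m n (M : 'M[RR]_(m, n)) : exists2 c, 0 <= c & op_bound M c.
Proof.
exists (\sum_i \sum_j `|M i j|); first by do 2 (apply: sumr_ge0 => ? _).
apply: bilinear_op_bound; first by do 2 (apply: sumr_ge0 => ? _).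
move=> x y x1 y1; rewrite dotE; apply: ler_sum => i _.
rewrite mxE mulr_sumr; apply: ler_sum => j _.
rewrite (le_trans (ler_norm _))// !normrM.
have hx := le_trans (coord_le_eucl_norm x i) x1.
have hy := le_trans (coord_le_eucl_norm y j) y1.
rewrite -[leRHS]mul1r ler_pM// ?mulr_ge0// -[leRHS]mulr1 ler_pM//.
Qed.

Lemma spec_norm_le m n (M : 'M[RR]_(m, n)) c : 0 <= c -> op_bound M c -> spec_norm M <= c.
Proof.
move=> c0 Mc; rewrite /spec_norm; set E := [set _ | _ in _].
(* In dimension 0 there is no unit vector, and [sup] of the empty set is 0. *)
have [E0|/set0P E0] := eqVneq E set0; first by rewrite E0 sup0.
apply: sup_le_ub => //= _ [v /= v1 <-].
by rewrite (le_trans (Mc v))// v1 mulr1.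
Qed.

Lemma spec_norm0 m n : spec_norm (0 : 'M[RR]_(m, n)) <= 0.
Proof. by apply: spec_norm_le => // v; rewrite mul0mx eucl_norm0 mul0r. Qed.

(** The diagonal of a Gram matrix consists of the squared norms of the columns. *)
Lemma gram_eq0 m n (M : 'M[RR]_(m, n)) : (forall i, (M^T *m M) i i = 0) -> M = 0.
Proof.
move=> h; apply/matrixP => i j; have := h j.
rewrite mxE => /eqP; rewrite psumr_eq0; last first.
  by move=> k _; rewrite mxE -expr2 sqr_ge0.
move=> /allP/(_ i (mem_index_enum _)); rewrite mxE -expr2 sqrf_eq0 => /eqP ->.
by rewrite mxE.
Qed.

End Euclid.

Section Pinv.

Lemma pinv_uniq m n (M : 'M[RR]_(m, n)) P Q : is_pinv M P -> is_pinv M Q -> P = Q.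
Proof.
move=> [a1 a2 a3 a4] [b1 b2 b3 b4].
have h1 : M *m P = M *m Q.
  by rewrite -a3 -[in LHS]b1 -(mulmxA (M *m Q)) trmx_mul b3 a3 !mulmxA a1.
have h2 : P *m M = Q *m M.
  by rewrite -a4 -[in LHS]b1 -mulmxA mulmxA trmx_mul b4 a4 -!mulmxA (mulmxA M P) a1.
by rewrite -a2 h2 -mulmxA h1 mulmxA b2.
Qed.

Lemma gram_unit m n (M : 'M[RR]_(m, n)) : row_free M^T -> M^T *m M \in unitmx.
Proof.
move=> fM; rewrite -row_free_unit -kermx_eq0; apply/eqP.
set K := kermx _; have K0 : K *m (M^T *m M) = 0 by exact: mulmx_ker.
have : (K *m M^T)^T = 0.
  apply: gram_eq0 => i; rewrite trmxK trmx_mul trmxK mulmxA -(mulmxA K) K0.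
  by rewrite mul0mx mxE.
move=> /(congr1 trmx); rewrite trmxK trmx0 => /eqP.
by rewrite mulmx_free_eq0// => /eqP.
Qed.

Lemma pinv_exists m n (M : 'M[RR]_(m, n)) : exists Q, is_pinv M Q.
Proof.
have [k [C [R [MCR fC fR]]]] : exists k (C : 'M[RR]_(m, k)) (R : 'M[RR]_(k, n)),
    [/\ M = C *m R, row_full C & row_free R].
  by exists (\rank M), (col_base M), (row_base M); rewrite mulmx_base col_base_full row_base_free.
have uC : C^T *m C \in unitmx by apply: gram_unit; rewrite /row_free mxrank_tr.
have uR : R *m R^T \in unitmx.
  by have := @gram_unit _ _ R^T; rewrite trmxK; apply.
have tC : (invmx (C^T *m C))^T = invmx (C^T *m C).
  by rewrite trmx_inv trmx_mul trmxK.
have tR : (invmx (R *m R^T))^T = invmx (R *m R^T).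
  by rewrite trmx_inv trmx_mul trmxK.
(* A right inverse of [R] times a left inverse of [C], chosen so that [M *m Q] and [Q *m M] are the
   orthogonal projectors on the column and row spaces. *)
pose Q := R^T *m invmx (R *m R^T) *m (invmx (C^T *m C) *m C^T).
have MQ : M *m Q = C *m invmx (C^T *m C) *m C^T.
  by rewrite MCR /Q !mulmxA -(mulmxA C R) mulmxK.
have QM : Q *m M = R^T *m invmx (R *m R^T) *m R.
  by rewrite MCR /Q !mulmxA -(mulmxA _ C^T C) mulmxKV.
exists Q; split.
- by rewrite MQ MCR !mulmxA -(mulmxA _ C^T C) mulmxKV.
- by rewrite QM /Q !mulmxA -(mulmxA _ R R^T) mulmxKV.
- by rewrite MQ !trmx_mul trmxK tC !mulmxA.
- by rewrite QM !trmx_mul trmxK tR !mulmxA.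
Qed.

Lemma mp_pinvP m n (M : 'M[RR]_(m, n)) : is_pinv M (mp_pinv M).
Proof. by have [Q hQ] := pinv_exists M; apply: (@xgetPex _ 0 [set Q | is_pinv M Q]); exists Q. Qed.

Lemma mp_pinv_sym n (M : 'M[RR]_n) : M^T = M -> (mp_pinv M)^T = mp_pinv M.
Proof.
move=> tM; have [a1 a2 a3 a4] := mp_pinvP M.
apply: (@pinv_uniq _ _ M); last exact: mp_pinvP.
move: a1 a2 a3 a4; set Q := mp_pinv M => a1 a2 a3 a4; split.
- by rewrite -[in LHS]tM -!trmx_mul mulmxA a1.
- by rewrite -{1}tM -!trmx_mul mulmxA a2.
- by rewrite -{1 2}tM -!trmx_mul !a4.
- by rewrite -{1 2}tM -!trmx_mul !a3.
Qed.

Lemma mp_pinv_comm n (M : 'M[RR]_n) : M^T = M -> mp_pinv M *m M = M *m mp_pinv M.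
Proof.
move=> tM; have [_ _ a3 _] := mp_pinvP M.
by rewrite -a3 trmx_mul mp_pinv_sym// tM.
Qed.

End Pinv.

(** * Positive semidefinite square roots *)

Section Sqrt.
Import complex.
Local Notation CC := (complex RR).
Local Notation toC := (real_complex RR).

Lemma interpolation (f : RR -> RR) (s : seq RR) :
  exists q : {poly RR}, forall x, x \in s -> q.[x] = f x.
Proof.
elim: s => [|a s [q hq]]; first by exists 0.
have [as_|as_] := boolP (a \in s).
  by exists q => x; rewrite inE => /orP[/eqP ->|]; exact: hq.
pose w := \prod_(b <- s) ('X - b%:P).
have w0 : w.[a] != 0.
  by rewrite -/(root w a) root_prod_XsubC.
exists (q + ((f a - q.[a]) / w.[a]) *: w) => x.
rewrite inE hornerD hornerZ => /orP[/eqP ->|xs]; first by rewrite divfK// addrC subrK.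
have /rootP -> : root w x by rewrite root_prod_XsubC.
by rewrite mulr0 addr0 hq.
Qed.

(** The eigenvalue is the Hermitian form of [A] at a row x + iy of [P]; as [A] is real, its real
    part is the sum of the quadratic forms at x and at y. *)
Lemma psd_eigenvalue_ge0 n (A : 'M[RR]_n) (P : 'M[CC]_n) (D : 'rV[CC]_n) j :
  psd A -> P \is unitarymx -> map_mx toC A = invmx P *m diag_mx D *m P ->
  0 <= complex.Re (D 0 j).
Proof.
move=> [_ pA] uP AE.
have -> : D 0 j = (P *m map_mx toC A *m (map_mx Num.conj P^T)) j j.
  rewrite AE !mulmxA mulmxV ?unitarymx_unit// mul1mx -invmx_unitary// mulmxK ?unitarymx_unit//.
  by rewrite mxE eqxx mulr1n.
have ReD (x y : CC) : complex.Re (x + y) = complex.Re x + complex.Re y.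
  by case: x y => [a b] [c d].
have ReS (F : 'I_n -> CC) : complex.Re (\sum_i F i) = \sum_i complex.Re (F i).
  by apply: (big_morph (@complex.Re RR)) => // x y; exact: ReD.
pose x := \col_k complex.Re (P j k); pose y := \col_k complex.Im (P j k).
suff -> : complex.Re ((P *m map_mx toC A *m (map_mx Num.conj P^T)) j j) =
  (x^T *m A *m x) 0 0 + (y^T *m A *m y) 0 0 by rewrite addr_ge0.
rewrite !mxE ReS -big_split/=; apply: eq_bigr => l _.
rewrite !mxE !mulr_suml ReS -big_split/=; apply: eq_bigr => k _.
rewrite !mxE; case: (P j k) => a b; case: (P j l) => c d /=.
by rewrite /Num.conj/=; ring.
Qed.

(* A real polynomial interpolating x^(1/4) on the spectrum transports the complex
   spectral theorem back to R; a fourth root is used because its square is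
   automatically positive semidefinite. *)
Lemma psd_fourth_root n (A : 'M[RR]_n.+1) : psd A ->
  exists q : {poly RR}, horner_mx A q ^+ 4 = A.
Proof.
move=> pA; have [tA _] := pA.
have hA : map_mx toC A \is hermsymmx.
  apply: realsym_hermsym.
    by apply/is_hermitianmxP; rewrite expr0 scale1r; apply/matrixP => i j; rewrite !mxE -[in LHS]tA mxE.
  by apply/mxOverP => i j; rewrite mxE; apply/CrealP; rewrite /Num.conj/= oppr0.
have /orthomx_spectralP AE := hermitian_normalmx hA.
have dR := hermitian_spectral_diag_real hA.
set P := spectralmx _ in AE; set D := spectral_diag _ in AE dR.
have uP : P \is unitarymx by exact: spectral_unitarymx.
have [q hq] := interpolation (fun x => Num.sqrt (Num.sqrt x))
  [seq complex.Re (D 0 j) | j <- enum 'I_n.+1].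
exists q; apply: (map_mx_inj (f := toC)).
have -> : horner_mx A q ^+ 4 = horner_mx A (q ^+ 4) by rewrite rmorphXn.
rewrite -[in RHS](horner_mx_X A).
rewrite !map_horner_mx; set B := map_mx _ A.
have -> : B = invmx P *m diag_mx D *m P by [].
rewrite !horner_mx_uconjC ?unitarymx_unit// !horner_mx_diag.
congr (_ *m diag_mx _ *m _); apply/rowP => j; rewrite !mxE.
have Dj : D 0 j = toC (complex.Re (D 0 j)).
  by rewrite RRe_real//; exact: (mxOverP dR).
rewrite Dj !horner_map/= hornerX; congr toC.
rewrite horner_exp hq; last by apply: map_f; rewrite mem_enum.
by rewrite (exprM _ 2 2) !sqr_sqrtr ?sqrtr_ge0// (psd_eigenvalue_ge0 _ pA uP AE).
Qed.

Lemma psd_sqrt_exists n (A : 'M[RR]_n) : psd A -> exists S, psd S /\ S *m S = A.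
Proof.
(* [horner_mx] lives in the ring of matrices of positive size; in size 0 all matrices coincide. *)
case: n A => [|n] A pA.
  exists A; split => //; first by apply/matrixP => -[].
have [q hq] := psd_fourth_root pA.
have [tA _] := pA.
set B := horner_mx A q in hq.
(* A polynomial in a symmetric matrix is symmetric, so [B *m B] equals [B^T *m B] and is positive
   semidefinite. *)
have tB : B^T = B.
  have AC : horner_mx A^T q = B^T.
    rewrite /B; elim/poly_ind: (q) => [|p c IH]; first by rewrite !raddf0.
    rewrite !rmorphD !rmorphM/= !horner_mx_X !horner_mx_C linearD/= tr_scalar_mx.
    have cA : horner_mx A^T p *m A^T = A^T *m horner_mx A^T p.
      exact: (comm_horner_mx p (comm_mx_refl A^T)).
    by rewrite trmx_mul -IH -cA.
  by rewrite -AC tA.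
exists (B *m B); split; last by rewrite -[RHS]hq (exprD _ 2 2) !expr2.
split; first by rewrite trmx_mul tB.
by move=> v; rewrite mulmxA -mulmxA -{1}tB -trmx_mul -/(dot _ _) -eucl_norm_sqr sqr_ge0.
Qed.

Lemma psd_sqrtP n (A : 'M[RR]_n) : psd A ->
  psd (psd_sqrt A) /\ psd_sqrt A *m psd_sqrt A = A.
Proof.
move=> /psd_sqrt_exists [S hS].
by apply: (@xgetPex _ 0 [set S | psd S /\ S *m S = A]); exists S.
Qed.

End Sqrt.

(** * Perturbation of the pseudoinverse *)

Section Factor.

(** Polar decomposition of a column basis: C (C^T C)^(-1/2) has orthonormal columns. The nets then
    live in dimension at most [\rank M], whatever the number of rows of [M]. *)
Lemma orthonormal_factor m n (M : 'M[RR]_(m, n)) :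
  exists k (U : 'M[RR]_(m, k)),
    [/\ (k <= \rank M)%N, U^T *m U = 1%:M & M = U *m (U^T *m M)].
Proof.
have [k [C [R [kM MCR fC]]]] : exists k (C : 'M[RR]_(m, k)) (R : 'M[RR]_(k, n)),
    [/\ (k <= \rank M)%N, M = C *m R & row_full C].
  by exists (\rank M), (col_base M), (row_base M); rewrite mulmx_base col_base_full.
have uC : C^T *m C \in unitmx by apply: gram_unit; rewrite /row_free mxrank_tr.
have pC : psd (C^T *m C).
  split; first by rewrite trmx_mul trmxK.
  by move=> v; rewrite mulmxA -mulmxA -trmx_mul -/(dot _ _) -eucl_norm_sqr sqr_ge0.
have [[tH _] HH] := psd_sqrtP pC.
set H := psd_sqrt _ in tH HH.
have uH : H \in unitmx by move: uC; rewrite -HH unitmx_mul => /andP[].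
have tV : (invmx H)^T = invmx H by rewrite trmx_inv tH.
exists k, (C *m invmx H); split => //.
  by rewrite trmx_mul tV !mulmxA -(mulmxA _ C^T) -HH mulmxA mulVmx// mul1mx mulmxV.
rewrite trmx_mul tV MCR !mulmxA -(mulmxA _ C^T C) -HH.
by rewrite mulmxA mulmxKV// mulmxKV.
Qed.

End Factor.

Section Perturbation.
Variables (D : nat) (Sig S : 'M[RR]_D).
Hypotheses (tSig : Sig^T = Sig) (tS : S^T = S) (SS : S *m S = mp_pinv Sig).
Local Notation P := (mp_pinv Sig).
Local Notation Pi := (Sig *m mp_pinv Sig).

Lemma range_proj_tr : Pi^T = Pi.
Proof. by have [_ _ ->] := mp_pinvP Sig. Qed.

Lemma range_proj_idem : Pi *m Pi = Pi.
Proof. by have [h _ _ _] := mp_pinvP Sig; rewrite mulmxA h. Qed.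

Lemma mul_range_proj : Pi *m Sig = Sig.
Proof. by have [h _ _ _] := mp_pinvP Sig. Qed.

Lemma pinv_mul_range_proj : P *m Pi = P.
Proof. by have [_ h _ _] := mp_pinvP Sig; rewrite mulmxA h. Qed.

(** The Gram matrix of S Pi - S is (Pi - 1) S S (Pi - 1), and S S is the pseudoinverse, which Pi
    fixes. *)
Lemma sqrt_mul_range_proj : S *m Pi = S.
Proof.
apply/eqP; rewrite -subr_eq0; apply/eqP; apply: gram_eq0 => i.
have -> : (S *m Pi - S)^T = Pi *m S - S.
  by rewrite [LHS]linearB/= trmx_mul range_proj_tr tS.
rewrite mulmxBr !mulmxBl !(mulmxA _ S Pi) -!(mulmxA _ S S) !SS -!(mulmxA _ P Pi).
by rewrite pinv_mul_range_proj subrr mxE.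
Qed.

Lemma range_proj_mul_sqrt : Pi *m S = S.
Proof. by have := congr1 trmx sqrt_mul_range_proj; rewrite trmx_mul range_proj_tr tS. Qed.

(** The leading S of S (S Sig S) = S is cancelled by multiplying by Sig S on the left, since Sig S S
    = Pi and Pi S = S. *)
Lemma sqrt_whitens : S *m Sig *m S = Pi.
Proof.
have SSS : S *m (S *m Sig *m S) = S.
  by rewrite !mulmxA SS mp_pinv_comm// range_proj_mul_sqrt.
transitivity (Sig *m (S *m (S *m (S *m Sig *m S)))).
  by rewrite (mulmxA S S) SS !mulmxA range_proj_mul_sqrt.
by rewrite SSS SS.
Qed.

Variable Sh : 'M[RR]_D.
Hypotheses (tSh : Sh^T = Sh) (PiSh : Pi *m Sh = Sh).
Local Notation Q := (mp_pinv Sh).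
Local Notation H := (Sh - Sig).

Lemma ShPi : Sh *m Pi = Sh.
Proof. by have := congr1 trmx PiSh; rewrite trmx_mul range_proj_tr tSh. Qed.

Lemma QPi : Q *m Pi = Q.
Proof.
have [_ QShQ _ _] := mp_pinvP Sh.
have QE : Q = Q *m Q *m Sh by rewrite -mulmxA mp_pinv_comm// mulmxA QShQ.
by rewrite {1}QE -mulmxA ShPi -QE.
Qed.

Lemma PiQ : Pi *m Q = Q.
Proof. by have := congr1 trmx QPi; rewrite trmx_mul range_proj_tr mp_pinv_sym. Qed.

(** Since Q = P Sig Q = Q Sig P, whatever annihilates P on either side annihilates Q too. *)
Lemma pinv_degenerate d1 d2 (A : 'M[RR]_(d1, D)) (B : 'M[RR]_(d2, D)) :
  A *m P = 0 \/ B *m P = 0 -> A *m (Q - P) *m B^T = 0.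
Proof.
case=> h0.
  rewrite mulmxBr h0 subr0 -PiQ -mp_pinv_comm// !mulmxA h0 !mul0mx//.
have h1 : P *m B^T = 0.
  by have := congr1 trmx h0; rewrite trmx_mul trmx0 mp_pinv_sym.
by rewrite -mulmxA mulmxBl h1 subr0 -QPi -!mulmxA h1 !mulmx0.
Qed.

Hypothesis SHS : op_bound (S *m H *m S) (1 / 2).

Lemma SHSE : S *m H *m S = S *m Sh *m S - Pi.
Proof. by rewrite mulmxBr mulmxBl sqrt_whitens. Qed.

(** Injectivity of 1 + W, column by column: |z| = |W z| <= |z| / 2 forces z = 0. *)
Lemma op_bound_half_eq0 m n (W : 'M[RR]_n) (Z : 'M[RR]_(n, m)) :
  op_bound W (1 / 2) -> Z = - (W *m Z) -> Z = 0.
Proof.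
move=> Wb ZE; apply/matrixP => i j.
have h : Z *m delta_mx j 0 = 0 :> 'cV_n.
  apply: eucl_norm_eq0; have := Wb (Z *m delta_mx j 0).
  rewrite mulmxA -[W *m Z]opprK -ZE mulNmx eucl_normN.
  by have := eucl_norm_ge0 (Z *m delta_mx j 0 : 'cV_n); lra.
by have := congr1 (fun v : 'cV_n => v i 0) h; rewrite -colE !mxE.
Qed.

(** [Sh *m Q] is the projector on the range of [Sh], which lies in that of [Pi]; equality means that
    no direction is lost. [Sig *m S] is the square root of Sigma, so [Z] is a whitened form of the
    lost part. It annihilates S Sh S = Pi + S H S, hence Z^T = - (S H S) Z^T and Z = 0. *)
Lemma ShQ : Sh *m Q = Pi.
Proof.
have [ShQSh _ _ _] := mp_pinvP Sh.
pose Z := (Pi - Sh *m Q) *m Sig *m S.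
have Z1 : Z *m (S *m Sh *m S) = 0.
  rewrite /Z !mulmxA -(mulmxA _ S S) SS -(mulmxA _ Sig) -(mulmxA _ Pi) PiSh.
  by rewrite (mulmxBl Pi) PiSh ShQSh subrr mul0mx.
have Z2 : Z *m Pi = Z by rewrite /Z -mulmxA sqrt_mul_range_proj.
have tW : (S *m H *m S)^T = S *m H *m S.
  by rewrite !trmx_mul tS [(Sh - Sig)^T]linearB/= tSh tSig mulmxA.
have Z3 : Z^T = - (S *m H *m S *m Z^T).
  have ZW : Z *m (S *m H *m S) = - Z by rewrite SHSE mulmxBr Z1 Z2 sub0r.
  by rewrite -{1}tW -(trmx_mul Z) ZW [(- Z)^T]linearN opprK.
have Z0 : Z = 0 by apply: trmx_inj; rewrite trmx0; exact: (op_bound_half_eq0 SHS Z3).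
have : Z *m S = 0 by rewrite Z0 mul0mx.
rewrite /Z -mulmxA SS -mulmxA mulmxBl range_proj_idem -(mp_pinv_comm tSh) -(mulmxA Q) ShPi.
by move=> /eqP; rewrite subr_eq0 (mp_pinv_comm tSh) => /eqP ->.
Qed.

Lemma op_bound_proj : op_bound Pi 1.
Proof.
move=> v; rewrite mul1r.
have [w0|w0] := eqVneq (eucl_norm (Pi *m v)) 0.
  by rewrite w0 eucl_norm_ge0.
have {}w0 : 0 < eucl_norm (Pi *m v) by rewrite lt_def w0 eucl_norm_ge0.
rewrite -(ler_pM2r w0) -expr2 eucl_norm_sqr dot_mulr range_proj_tr mulmxA range_proj_idem.
by rewrite dotC dot_le.
Qed.

Local Notation W := (S *m Sig *m Q *m Sig *m S).

(** [W] is the inverse of S Sh S on the range of [Pi]. From W = Pi - (S H S) W follows |W v| <= |v|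
    + |W v| / 2, which replaces a Neumann series. *)
Lemma op_bound_whitened_pinv : op_bound W 2.
Proof.
have W1 : S *m Sh *m S *m W = Pi.
  rewrite !mulmxA -(mulmxA _ S S) SS -(mulmxA _ P) mp_pinv_comm//.
  rewrite -(mulmxA _ Sh) ShPi -(mulmxA _ Sh) ShQ.
  by rewrite -(mulmxA _ Pi) mul_range_proj sqrt_whitens.
have W2 : W = Pi - (S *m H *m S) *m W.
  rewrite SHSE mulmxBl W1 opprB addrC !mulmxA range_proj_mul_sqrt.
  by rewrite subrK.
move=> v; have := eucl_normD (Pi *m v) (- (S *m H *m S *m W *m v)).
rewrite -mulmxBl -W2 eucl_normN -(mulmxA (S *m H *m S)).
have := SHS (W *m v); have := op_bound_proj v; lra.
Qed.

(** The resolvent identity Q - P = - P H Q applied twice gives - P H P + P H Q H P, and Q = S W S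
    splits the quadratic term into two whitened factors. *)
Lemma pinv_resolvent : Q - P = - (P *m H *m P) + (P *m H *m S) *m W *m (S *m H *m P).
Proof.
have SWS : S *m W *m S = Q.
  rewrite !mulmxA SS -(mulmxA _ S S) SS mp_pinv_comm// PiQ -(mulmxA Q) QPi //.
have -> : (P *m H *m S) *m W *m (S *m H *m P) = P *m (H *m Q *m H) *m P.
  by move: SWS; set W0 := W; move: W0 => W0 <-; rewrite !mulmxA.
have [_ PSP _ _] := mp_pinvP Sig.
have -> : H *m Q *m H = Sh - Sig - Sig + Sig *m Q *m Sig.
  rewrite mulmxBl ShQ mulmxBr !mulmxBl PiSh -(mulmxA Sig Q Sh) (mp_pinv_comm tSh) ShQ.
  rewrite mul_range_proj -(mp_pinv_comm tSig) mulmxA mul_range_proj.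
  move: Sh Sig (_ *m _) => a p q; apply/matrixP => i j; rewrite !mxE; ring.
have -> : P *m H *m P = P *m Sh *m P - P by rewrite mulmxBr mulmxBl PSP.
have -> : P *m (Sh - Sig - Sig + Sig *m Q *m Sig) *m P = P *m Sh *m P - P - P + Q.
  rewrite mulmxDr mulmxDl !mulmxBr !mulmxBl PSP; congr (_ + _).
  by rewrite !mulmxA mp_pinv_comm// PiQ -mulmxA QPi.
move: (P *m Sh *m P) P Q => a p q; apply/matrixP => i j; rewrite !mxE; ring.
Qed.

Lemma pinv_perturbation d1 d2 (A : 'M[RR]_(d1, D)) (B : 'M[RR]_(d2, D)) x y z :
  0 <= y -> 0 <= z ->
  op_bound (A *m P *m H *m (B *m P)^T) x ->
  op_bound (A *m P *m H *m S) y -> op_bound (S *m H *m (B *m P)^T) z ->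
  op_bound (A *m (Q - P) *m B^T) (x + 2 * y * z).
Proof.
move=> y0 z0; rewrite trmx_mul mp_pinv_sym// => hx hy hz.
rewrite pinv_resolvent mulmxDr mulmxDl; apply: op_boundD.
  by rewrite mulmxN mulNmx; apply: op_boundN; rewrite !mulmxA in hx *.
have -> : A *m (P *m H *m S *m W *m (S *m H *m P)) *m B^T =
  (A *m P *m H *m S) *m W *m (S *m H *m (P *m B^T)) by rewrite !mulmxA.
rewrite (mulrC 2); apply: op_bound_mul => //; first by rewrite mulr_ge0.
by apply: op_bound_mul => //; exact: op_bound_whitened_pinv.
Qed.

End Perturbation.

(** * Nets of Euclidean balls *)

Section Net.

(* Each f in the set has weight at least 2^-m for the product weight
   f |-> 2^-(\sum_i (f i).2), whose total mass is at most 4^k. *)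
Lemma card_small_sum k m :
  (#|[pred f : {ffun 'I_k -> bool * 'I_m.+1} | (\sum_i (f i).2 <= m)%N]| <= 2 ^ (m + 2 * k))%N.
Proof.
rewrite -(ler_nat RR) natrX.
pose g (p : bool * 'I_m.+1) : RR := 2^-1 ^+ p.2.
have g0 p : 0 <= g p by rewrite exprn_ge0// invr_ge0.
have sg : \sum_p g p <= 2 ^+ 2.
  rewrite -(pair_bigA _ (fun _ i => g (true, i)))/= big_bool/=.
  suff : \sum_(j < m.+1) 2^-1 ^+ j <= 2 :> RR by rewrite /g/= => h; lra.
  have := @subrXX RR 1 2^-1 m.+1; rewrite expr1n.
  under eq_bigr do rewrite expr1n mul1r.
  have : 0 <= 2^-1 ^+ m.+1 :> RR by rewrite exprn_ge0// invr_ge0.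
  lra.
rewrite exprD exprM -sum1_card natr_sum.
apply: (@le_trans _ _ (2 ^+ m * \sum_(f : {ffun 'I_k -> bool * 'I_m.+1}) \prod_i g (f i))).
  rewrite mulr_sumr [leRHS](bigID [pred f : {ffun 'I_k -> bool * 'I_m.+1} | (\sum_i (f i).2 <= m)%N])/=.
  rewrite -[leLHS]addr0 lerD//; last first.
    by apply: sumr_ge0 => f _; rewrite mulr_ge0 ?exprn_ge0// prodr_ge0.
  apply: ler_sum => f fm; have {fm}fm : (\sum_i (f i).2 <= m)%N := fm.
  rewrite prodrXr exprVn -ler_pdivrMr ?invr_gt0 ?exprn_gt0// div1r invrK.
  by rewrite ler_weXn2l// ler1n.
rewrite ler_wpM2l ?exprn_ge0//.
rewrite -(bigA_distr_bigA (fun _ : 'I_k => g)) prodr_const card_ord.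
by rewrite lerXn2r ?nnegrE ?sumr_ge0 ?exprn_ge0.
Qed.

(* Coordinates are rounded towards zero on a grid of mesh 1 / (4 sqrt r): this does
   not increase the norm, and the integer coordinates n_i of a grid point obtained
   in this way satisfy \sum_i n_i <= \sum_i n_i^2 <= 16 r. *)
Lemma ball_net (k r : nat) : (k <= r)%N -> (0 < r)%N ->
  exists s : seq 'cV[RR]_k, [/\ (size s <= 2 ^ (18 * r))%N,
    forall x, x \in s -> eucl_norm x <= 1 &
    forall x, eucl_norm x <= 1 -> exists2 y, y \in s & eucl_norm (x - y) <= 1 / 4].
Proof.
move=> kr r0; set m := (16 * r)%N.
pose F := {ffun 'I_k -> bool * 'I_m.+1}.
pose c : RR := 4 * Num.sqrt r%:R.
have r0' : 0 < r%:R :> RR by rewrite ltr0n.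
have c0 : 0 < c by rewrite mulr_gt0// sqrtr_gt0.
have c2 : c ^+ 2 = m%:R by rewrite exprMn sqr_sqrtr ?ltW// natrM; congr (_ * _); ring.
pose pt (f : F) : 'cV[RR]_k := \col_i ((-1) ^+ (f i).1 * ((f i).2%:R / c)).
pose A := [pred f : F | (\sum_i (f i).2 <= m)%N].
exists [seq pt f | f <- enum A & eucl_norm (pt f) <= 1]; split.
- rewrite size_map size_filter (leq_trans (count_size _ _))// -cardE.
  rewrite (leq_trans (card_small_sum _ _))// leq_pexp2l// /m.
  by rewrite (_ : 18 * r = 16 * r + 2 * r)%N ?leq_add2l ?leq_mul2l// -mulnDl.
- by move=> x /mapP[f]; rewrite mem_filter => /andP[h _] ->.
move=> x x1.
pose a i := c * `|x i 0|.
have a0 i : 0 <= a i by rewrite mulr_ge0// ltW.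
have trl i : (Num.truncn (a i))%:R <= a i by rewrite truncn_le.
have trg i : a i < (Num.truncn (a i))%:R + 1 by rewrite natr1 truncnS_gt.
have sa : \sum_i (a i) ^+ 2 <= m%:R.
  under eq_bigr do rewrite exprMn c2 real_normK ?num_real//.
  rewrite -mulr_sumr -[leRHS]mulr1 ler_wpM2l// -(@expr1n RR 2).
  under eq_bigr do rewrite expr2.
  by rewrite -dotE -eucl_norm_sqr lerXn2r ?nnegrE ?eucl_norm_ge0.
have st : (\sum_i Num.truncn (a i) <= m)%N.
  rewrite -(ler_nat RR) (le_trans _ sa)// natr_sum; apply: ler_sum => i _.
  rewrite (le_trans _ (lerXn2r 2 _ _ (trl i))) ?nnegrE// -natrX ler_nat.
  by case: (Num.truncn _) => // n; rewrite expnS expn1 leq_pmull.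
have tm i : (Num.truncn (a i) < m.+1)%N.
  by rewrite ltnS (leq_trans _ st)// (bigD1 i)//= leq_addr.
pose f : F := [ffun i => (x i 0 < 0, Ordinal (tm i))].
have ptE i : pt f i 0 = (-1) ^+ (x i 0 < 0)%R * ((Num.truncn (a i))%:R / c).
  by rewrite mxE ffunE.
have xE i : x i 0 = (-1) ^+ (x i 0 < 0)%R * (a i / c).
  by rewrite /a (mulrC c) mulfK ?lt0r_neq0// -numEsign.
have leN (u v : 'cV[RR]_k) b : 0 <= b -> (forall i, u i 0 ^+ 2 <= (b * v i 0) ^+ 2) ->
    eucl_norm u <= b * eucl_norm v.
  move=> b0 h; rewrite -ler_sqr ?nnegrE ?mulr_ge0 ?eucl_norm_ge0// exprMn !eucl_norm_sqr !dotE.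
  by rewrite mulr_sumr; apply: ler_sum => i _; have := h i; rewrite exprMn !expr2.
have n1 : eucl_norm (pt f) <= 1.
  rewrite (le_trans _ x1)// -[leRHS]mul1r; apply: leN => // i.
  have ci : 0 <= c^-1 by rewrite invr_ge0 ltW.
  rewrite mul1r ptE [in leRHS]xE exprMn [leRHS]exprMn !sqrr_sign !mul1r.
  by rewrite lerXn2r ?nnegrE ?mulr_ge0// ler_wpM2r.
exists (pt f).
  have fA : f \in A.
    by rewrite inE/= (leq_trans _ st)// leq_sum// => i _; rewrite ffunE.
  by apply/mapP; exists f => //; rewrite mem_filter n1 mem_enum.
have -> : 1 / 4 = c^-1 * Num.sqrt r%:R :> RR.
  by rewrite /c invfM mulfVK ?div1r// lt0r_neq0// sqrtr_gt0.
have h : eucl_norm (x - pt f) <= c^-1 * eucl_norm (const_mx 1 : 'cV[RR]_k).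
  apply: leN; first by rewrite invr_ge0 ltW.
  move=> i; rewrite mxE [(- pt f) i 0]mxE ptE {1}xE -mulrBr exprMn sqrr_sign mul1r -mulrBl.
  rewrite mxE mulr1 exprMn ler_piMl ?sqr_ge0//.
  by have := trl i; have := trg i; nra.
rewrite (le_trans h)// ler_wpM2l ?invr_ge0 ?(ltW c0)//.
rewrite ler_wsqrtr//.
by under eq_bigr do rewrite mxE expr1n; rewrite sumr_const card_ord ler_nat.
Qed.

(** Replacing each argument by a net point costs 1/4 of the norm g, so g <= c + g / 2. This is
    absorbed because g, a supremum, is finite beforehand. *)
Lemma net_op_bound k l (M : 'M[RR]_(k, l)) (s1 : seq 'cV[RR]_k) (s2 : seq 'cV[RR]_l) c :
  0 <= c ->
  (forall x, x \in s1 -> eucl_norm x <= 1) ->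
  (forall x, eucl_norm x <= 1 -> exists2 y, y \in s1 & eucl_norm (x - y) <= 1 / 4) ->
  (forall x, eucl_norm x <= 1 -> exists2 y, y \in s2 & eucl_norm (x - y) <= 1 / 4) ->
  (forall x y, x \in s1 -> y \in s2 -> dot x (M *m y) <= c) ->
  op_bound M (2 * c).
Proof.
move=> c0 b1 n1 n2 h.
have [b b0 Mb] := op_bound_exists M.
pose E := [set eucl_norm (M *m v) | v in [set v : 'cV[RR]_l | eucl_norm v <= 1]].
have hE : has_sup E.
  split; first by exists (eucl_norm (M *m 0)), 0 => //=; rewrite eucl_norm0.
  exists b => _ [v /= v1 <-]; rewrite (le_trans (Mb v))//.
  by rewrite -[leRHS]mulr1 ler_wpM2l.
have Eub v : eucl_norm v <= 1 -> eucl_norm (M *m v) <= sup E.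
  by move=> v1; apply: ub_le_sup; [case: hE|exists v].
have g0 : 0 <= sup E.
  by rewrite (le_trans _ (Eub 0 _)) ?eucl_norm_ge0 ?eucl_norm0.
have gM : op_bound M (sup E).
  apply: bilinear_op_bound => // x y x1 y1; rewrite (le_trans (dot_le _ _))//.
  rewrite -[leRHS]mul1r ler_pM ?eucl_norm_ge0//; exact: Eub.
have gM' : op_bound M (c + sup E / 2).
  apply: bilinear_op_bound; first by rewrite addr_ge0// divr_ge0.
  move=> x y x1 y1.
  have [x' x's dx] := n1 x x1; have [y' y's dy] := n2 y y1.
  have -> : dot x (M *m y) = dot (x - x') (M *m y) + dot x' (M *m (y - y')) + dot x' (M *m y').
    by rewrite -addrA -dotDr -mulmxDr subrK -dotDl subrK.
  have h1 : dot (x - x') (M *m y) <= 1 / 4 * sup E.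
    by rewrite (le_trans (dot_le _ _))// ler_pM ?eucl_norm_ge0//; exact: Eub.
  have h2 : dot x' (M *m (y - y')) <= 1 * (sup E * (1 / 4)).
    rewrite (le_trans (dot_le _ _))// ler_pM ?eucl_norm_ge0 ?b1//.
    by rewrite (le_trans (gM _))// ler_wpM2l.
  have := h x' y' x's y's; lra.
suff sE : sup E <= 2 * c by apply: op_bound_le gM.
suff : sup E <= c + sup E / 2 by lra.
apply: sup_le_ub; first by case: hE.
move=> _ [v /= v1 <-]; rewrite (le_trans (gM' v))// -[leRHS]mulr1 ler_wpM2l//.
by rewrite addr_ge0// divr_ge0.
Qed.

End Net.

(** * Independence *)

Section Rects.
Variable n : nat.

Definition rects : set (set 'cV[RR]_n) :=
  [set [set v : 'cV[RR]_n | forall j, Bs j (v j 0)] | Bs in [set Bs : 'I_n -> set RR | forall j, measurable (Bs j)]].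

(* [same_law] and [mutually_independent] are tested on the pi-system [rects], so
   column vectors are given the sigma-algebra it generates. *)
Definition vecm := g_sigma_algebraType rects.

Lemma rectsI : setI_closed rects.
Proof.
move=> _ _ [B1 m1 <-] [B2 m2 <-]; exists (fun j => B1 j `&` B2 j).
  by move=> j; apply: measurableI; [exact: m1|exact: m2].
apply/seteqP; split => v /= h; first by split => j; have [] := h j.
by move=> j; split; apply h.
Qed.

Lemma rectsT : rects setT.
Proof. by exists (fun=> setT) => //; apply/seteqP; split. Qed.

Lemma measurable_coord (j : 'I_n) : measurable_fun [set: vecm] (fun v : vecm => v j 0 : RR).
Proof.
move=> _ B mB; rewrite setTI; apply: sub_sigma_algebra.
exists (fun i => if i == j then B else setT) => [i /=|]; first by case: ifP.
apply/seteqP; split => v /=.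
  by move=> /(_ j); rewrite eqxx.
by move=> Bv i; case: eqVneq => [->|].
Qed.

Context d (T : measurableType d).

Lemma measurable_rect (X : T -> 'cV[RR]_n) G : rvec_measurable X -> rects G ->
  measurable (X @^-1` G).
Proof.
move=> mX [Bs mB <-].
have -> : X @^-1` [set v : 'cV[RR]_n | forall j, Bs j (v j 0)] =
    \bigcap_(j in [set: 'I_n]) ((fun w => X w j 0) @^-1` Bs j).
  by apply/seteqP; split => w /= h j => [_|]; apply: h.
apply: fin_bigcap_measurable; first exact: finite_finset.
by move=> j _; rewrite -[X in measurable X]setTI; apply: mX; [|exact: mB].
Qed.

Lemma measurable_vec (X : T -> 'cV[RR]_n) : rvec_measurable X ->
  measurable_fun setT (X : T -> vecm).
Proof.
move=> mX; apply: (@measurability _ _ _ vecm _ _ rects) => //.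
by move=> _ [G hG <-]; rewrite setTI; exact: measurable_rect.
Qed.

End Rects.

Section Indep.
Import HBNNSimple.
Context d (T : measurableType d) (P : probability T RR) (n : nat).
Local Open Scope ereal_scope.
Local Notation V := (vecm n).

Variables (X : T -> 'cV[RR]_n) (h : T -> RR).
Hypotheses (mX : rvec_measurable X) (mh : measurable_fun setT h) (h0 : forall w, (0 <= h w)%R).
Hypothesis hoo : \int[P]_w (h w)%:E < +oo.
Local Notation c := (\int[P]_w (h w)%:E).
Hypothesis hX : forall G, rects G -> \int[P]_(w in X @^-1` G) (h w)%:E = c * P (X @^-1` G).

Let mhE (A : set T) : measurable_fun A (fun w => (h w)%:E : \bar RR).
Proof. by apply/measurable_EFinP; exact: measurable_funTS. Qed.

Let mpre (S : set V) : measurable S -> measurable (X @^-1` S).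
Proof. by move=> mS; rewrite -[_ @^-1` _]setTI; exact: (measurable_vec mX). Qed.

Let c0 : 0 <= c. Proof. by apply: integral_ge0 => w _; rewrite lee_fin. Qed.

Let cfin : c \is a fin_num. Proof. by rewrite ge0_fin_numE. Qed.

(** Both sides are finite measures of [S], so their agreement on rectangles extends by Dynkin's
    theorem. The weight [h] stands for the product of all the other factors. *)
Lemma indep_set (S : set V) : measurable S ->
  \int[P]_(w in X @^-1` S) (h w)%:E = c * P (X @^-1` S).
Proof.
move=> mS; apply: (@dynkin_induction _ V (@rects n)
  [set S | \int[P]_(w in X @^-1` S) (h w)%:E = c * P (X @^-1` S)]) => //=.
- exact: rectsI.
- by rewrite preimage_setT probability_setT mule1.
- move=> B mB IH; have mB' := mpre mB.
  have : c = \int[P]_(w in X @^-1` B `|` ~` (X @^-1` B)) (h w)%:E by rewrite setUv.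
  have dB : [disjoint X @^-1` B & ~` (X @^-1` B)] by rewrite disj_set2E setICr.
  have h0E x : (X @^-1` B `|` ~` (X @^-1` B)) x -> 0 <= (h x)%:E by rewrite lee_fin.
  rewrite (ge0_integral_setU P mB' (measurableC mB') (@mhE _) h0E dB).
  rewrite IH preimage_setC probability_setC// => cE.
  rewrite muleBr// mule1 {1}cE addeAC subee ?add0e//.
  by rewrite fin_numM// fin_num_measure.
- move=> F mF tF IH.
  have tFX : trivIset setT (fun k => X @^-1` F k).
    by apply/trivIsetP => i j _ _ ij; rewrite -preimage_setI (trivIsetP.1 tF) ?preimage_set0.
  rewrite preimage_bigcup ge0_integral_bigcup//=.
  + have -> : P (\bigcup_k (X @^-1` F k)) = \sum_(i <oo) P (X @^-1` F i).
      rewrite measure_bigcup//=; first by apply: eq_eseriesl => i; rewrite in_setT.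
      by move=> k _; exact: mpre.
    rewrite -(fineK cfin) -nneseriesZl//; apply: eq_eseriesr => i _.
    by rewrite fineK.
  + by move=> k; exact: mpre.
  + by move=> x _; rewrite lee_fin.
Qed.

(** Simple functions increasing to [f] reduce the claim to [indep_set] on level sets; monotone
    convergence concludes. [expand] and [lim_int] carry a weight [k] so as to serve both sides: [h]
    on the left, 1 on the right. *)
Lemma indep_fun (f : V -> RR) : measurable_fun setT f -> (forall v, (0 <= f v)%R) ->
  \int[P]_w (h w * f (X w))%:E = c * \int[P]_w (f (X w))%:E.
Proof.
move=> mf f0.
have mfE : measurable_fun [set: V] (fun v => (f v)%:E : \bar RR) by exact/measurable_EFinP.
pose g := nnsfun_approx measurableT mfE.
have expand (k : T -> RR) m : measurable_fun setT k -> (forall w, (0 <= k w)%R) ->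
    \int[P]_w (k w * g m (X w))%:E =
    \sum_(y \in range (g m)) (y%:E * \int[P]_(w in X @^-1` (g m @^-1` [set y])) (k w)%:E).
  move=> mk k0.
  have mS y : measurable (X @^-1` (g m @^-1` [set y])) by exact: mpre.
  have y0 y w : (0 <= y * (k w * \1_(X @^-1` (g m @^-1` [set y])) w))%R.
    rewrite indicE; have [|_] := boolP (w \in _); last by rewrite !mulr0.
    by rewrite inE/= => <-; rewrite !mulr_ge0.
  have mk1 y : measurable_fun setT (fun w => k w * \1_(X @^-1` (g m @^-1` [set y])) w)%R.
    by apply: measurable_funM => //; exact: measurable_indic.
  transitivity (\int[P]_w (\sum_(y \in range (g m))
      (y * (k w * \1_(X @^-1` (g m @^-1` [set y])) w))%:E)).
    apply: eq_integral => w _; rewrite (fimfunE (g m)) fsumEFin//.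
    congr (_ %:E); rewrite mulrC mulr_fsuml//; apply: eq_fsbigr => y _.
    by rewrite -mulrA (mulrC (\1_ _ _)).
  rewrite ge0_integral_fsum//; last 2 first.
  - by move=> y; apply/measurable_EFinP; exact: measurable_funM.
  - by move=> y w _; rewrite lee_fin.
  apply: eq_fsbigr => y /set_mem[v _ <-].
  under eq_integral do rewrite EFinM.
  rewrite ge0_integralZl_EFin//; last 2 first.
  - by move=> w _; rewrite lee_fin mulr_ge0.
  - exact/measurable_EFinP.
  congr (_ * _); rewrite [RHS]integral_mkcond; apply: eq_integral => w _.
  by rewrite patchE indicE; case: ifP => _; rewrite ?mulr1 ?mulr0.
have step m : \int[P]_w (h w * g m (X w))%:E = c * \int[P]_w (g m (X w))%:E.
  have -> : \int[P]_w (g m (X w))%:E = \int[P]_w (1 * g m (X w))%:E.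
    by apply: eq_integral => w _; rewrite mul1r.
  rewrite !expand// -(fineK cfin) ge0_mule_fsumr; last first.
    move=> y; have [y0|y0] := leP 0%R y.
      by rewrite mule_ge0 ?lee_fin// integral_ge0.
    suff -> : g m @^-1` [set y] = set0 by rewrite preimage_set0 integral_set0 mule0.
    by apply: preimage_nnfun0.
  apply: eq_fsbigr => y _; rewrite fineK// indep_set//.
  have mS : measurable (X @^-1` (g m @^-1` [set y])) by exact: mpre.
  have := integral_cst P mS 1%E; rewrite mul1e => ->.
  by rewrite muleCA.
have lim_int (k : T -> RR) : measurable_fun setT k -> (forall w, (0 <= k w)%R) ->
    \int[P]_w (k w * g m (X w))%:E @[m --> \oo] --> \int[P]_w (k w * f (X w))%:E.
  move=> mk k0.
  have gk w : (k w * g m (X w))%:E @[m --> \oo] --> (k w * f (X w))%:E.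
    under eq_fun do rewrite EFinM.
    rewrite EFinM; apply: cvgeZl => //; apply: cvg_nnsfun_approx => // v _.
    by rewrite lee_fin.
  have -> : \int[P]_w (k w * f (X w))%:E =
      \int[P]_w limn (fun m => (k w * g m (X w))%:E).
    by apply: eq_integral => w _; apply/esym/cvg_lim.
  apply: cvg_monotone_convergence => //.
  - move=> m; apply/measurable_EFinP; apply: measurable_funM => //.
    have mg : measurable_fun [set: vecm n] (g m : vecm n -> RR) by exact: measurable_funP.
    exact: (measurableT_comp mg (measurable_vec mX)).
  - by move=> m w _; rewrite lee_fin mulr_ge0.
  - move=> w _ i j ij; rewrite lee_fin ler_wpM2l//.
    by move/lefP: (nd_nnsfun_approx measurableT mfE ij) => /(_ (X w)).
have h1 : \int[P]_w (h w * g m (X w))%:E @[m --> \oo] --> \int[P]_w (h w * f (X w))%:E.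
  exact: lim_int.
have h2 : \int[P]_w (h w * g m (X w))%:E @[m --> \oo] --> c * \int[P]_w (f (X w))%:E.
  under eq_fun do rewrite step.
  apply: cvgeZl => //; have := lim_int (cst 1%R) (measurable_cst _) (fun=> ler01).
  by under eq_fun do under eq_integral do rewrite mul1r; under eq_integral do rewrite mul1r.
exact: (cvg_unique _ h1 h2).
Qed.

End Indep.

Section IndepProd.
Context d (T : measurableType d) (P : probability T RR) (n N : nat).
Local Open Scope ereal_scope.
Local Notation V := (vecm n).
Variable Xs : 'I_N -> T -> 'cV[RR]_n.
Hypotheses (mXs : forall i, rvec_measurable (Xs i)) (iXs : mutually_independent P Xs).

Definition good_factor (i : 'I_N) (f : V -> RR) :=
  [/\ measurable_fun setT f, forall v, (0 <= f v)%R & \int[P]_w (f (Xs i w))%:E < +oo].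

Lemma measurable_rects (G : set V) : rects G -> measurable G.
Proof. exact: sub_sigma_algebra. Qed.

Lemma integral_indic_rect i (G : set V) : rects G ->
  \int[P]_w (\1_G (Xs i w))%:E = P (Xs i @^-1` G).
Proof.
move=> rG; have mG := measurable_rect (mXs i) rG.
have := integral_indic P measurableT mG; rewrite setIT => <-.
by apply: eq_integral => w _.
Qed.

Lemma good_indic i (G : set V) : rects G -> good_factor i \1_G.
Proof.
move=> rG; split.
- by apply: measurable_indic; exact: measurable_rects.
- by move=> v; rewrite indicE.
- rewrite integral_indic_rect// (le_lt_trans (probability_le1 P _)) ?ltry//.
  exact: measurable_rect.
Qed.

(* Indicators of rectangles are replaced by arbitrary factors one index at a time:
   the factors of index at least k are still indicators. *)
Lemma integral_prod_indep_aux k (f : 'I_N -> V -> RR) : (k <= N)%N ->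
  (forall i, good_factor i (f i)) ->
  (forall i : 'I_N, (k <= i)%N -> exists2 G, rects G & f i = \1_G) ->
  \int[P]_w (\prod_i f i (Xs i w))%:E = \prod_i \int[P]_w (f i (Xs i w))%:E.
Proof.
elim: k f => [|k IH] f kN fg fr.
  have /choice[Bs hB] : forall i, exists Bs : 'I_n -> set RR, (forall j, measurable (Bs j)) /\
      f i = \1_[set v : 'cV[RR]_n | forall j, Bs j (v j 0%R)].
    by move=> i; have [G [Bs mB <-] ->] := fr i (leq0n _); exists Bs.
  under [RHS]eq_bigr => i _.
    have [mB ->] := hB i.
    rewrite integral_indic_rect; last by exists (Bs i).
    over.
  rewrite -[RHS](iXs (fun i => (hB i).1)).
  set E := [set w | _].
  have mE : measurable E.
    have -> : E = \bigcap_(i in [set: 'I_N]) (Xs i @^-1` [set v : 'cV[RR]_n | forall j, Bs i j (v j 0%R)]).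
      by apply/seteqP; split => w /= h i => [_|]; apply: h.
    apply: fin_bigcap_measurable; first exact: finite_finset.
    by move=> i _; apply: measurable_rect => //; exists (Bs i) => //; have [] := hB i.
  have := integral_indic P measurableT mE; rewrite setIT => <-.
  apply: eq_integral => w _; congr (_ %:E); rewrite indicE.
  have [wE|wE] := boolP (w \in E).
    rewrite big1// => i _; have [_ ->] := hB i; rewrite indicE mem_set//.
    by move=> j; have := set_mem wE; apply.
  apply/eqP/prodf_eq0.
  have [i hi] : exists i, ~ forall j, Bs i j (Xs i w j 0%R).
    by apply/existsNP => h; move/negP: wE; apply; exact: mem_set.
  by exists i => //; have [_ ->] := hB i; rewrite indicE memNset.
(* The index whose factor is freed at this stage; [h] collects the other factors. *)
pose o : 'I_N := Ordinal kN.
pose h w := (\prod_(i < N | i != o) f i (Xs i w))%R.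
pose Q := \prod_(i < N | i != o) \int[P]_w (f i (Xs i w))%:E.
have fX i : measurable_fun setT (fun w => f i (Xs i w)).
  have [mf _ _] := fg i; exact: (measurableT_comp mf (measurable_vec (mXs i))).
have mh : measurable_fun setT h.
  rewrite /h; under eq_fun do rewrite big_mkcond/=.
  by apply: measurable_prod => i _; have [_|_] := boolP (i != o); [exact: fX|exact: measurable_cst].
have h0 w : (0 <= h w)%R by apply: prodr_ge0 => i _; have [_ f0 _] := fg i; exact: f0.
have fin i : \int[P]_w (f i (Xs i w))%:E \is a fin_num.
  have [_ f0 foo] := fg i.
  by rewrite ge0_fin_numE// integral_ge0// => w _; rewrite lee_fin.
have Qfin : Q \is a fin_num.
  by rewrite /Q; elim/big_ind: _ => // x y xf yf; rewrite fin_numM.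
(* The induction hypothesis with factor [o] replaced by the indicator of a rectangle is the
   factorisation that [indep_fun] requires. *)
have hG G : rects G -> \int[P]_(w in Xs o @^-1` G) (h w)%:E = P (Xs o @^-1` G) * Q.
  move=> rG; pose g i := if i == o then \1_G : V -> RR else f i.
  have := IH g (ltnW kN).
  have gg i : good_factor i (g i).
    by rewrite /g; case: eqP => // _; exact: good_indic.
  have gr (i : 'I_N) : (k <= i)%N -> exists2 G, rects G & g i = \1_G.
    rewrite /g; case: eqVneq => [_ _|io ki]; first by exists G.
    by apply: fr; rewrite ltn_neqAle ki andbT eq_sym.
  move=> /(_ gg gr); rewrite (bigD1 o)//= {2}/g eqxx integral_indic_rect//.
  have -> : \prod_(i < N | i != o) \int[P]_w (g i (Xs i w))%:E = Q.
    by apply: eq_bigr => i /negPf io; rewrite /g io.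
  move=> <-; rewrite integral_mkcond; apply: eq_integral => w _.
  rewrite (bigD1 o)//= {1}/g eqxx patchE indicE.
  have -> : (\prod_(i < N | i != o) g i (Xs i w))%R = h w.
    by apply: eq_bigr => i /negPf io; rewrite /g io.
  have -> : (w \in Xs o @^-1` G) = (Xs o w \in G) by apply/idP/idP; rewrite !inE.
  by case: ifP => _; rewrite ?mul1r ?mul0r.
have hQ : \int[P]_w (h w)%:E = Q.
  by have := hG setT (@rectsT n); rewrite preimage_setT probability_setT mul1e.
rewrite (bigD1 o)//= -/Q.
have [mf f0 foo] := fg o.
under eq_integral do rewrite (bigD1 o)//= -/(h _) mulrC.
rewrite (indep_fun (mXs o) mh h0)//; first by rewrite hQ muleC.
- by rewrite hQ ltey_eq Qfin.
- by move=> G rG; rewrite hG// hQ muleC.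
Qed.

Lemma integral_prod_indep (f : 'I_N -> V -> RR) : (forall i, good_factor i (f i)) ->
  \int[P]_w (\prod_i f i (Xs i w))%:E = \prod_i \int[P]_w (f i (Xs i w))%:E.
Proof.
move=> fg; apply: (@integral_prod_indep_aux N) => // i.
by rewrite leqNgt ltn_ord.
Qed.

End IndepProd.

(** * Exponential moments *)

Section SameLaw.
Context d (T : measurableType d) (P : probability T RR) (n : nat).
Local Open Scope ereal_scope.

(** The two pushforward measures are finite and agree on the pi-system that generates the
    sigma-algebra of [vecm]. *)
Lemma same_law_integral (X Y : T -> 'cV[RR]_n) (f : vecm n -> RR) :
  rvec_measurable X -> rvec_measurable Y -> same_law P X Y ->
  measurable_fun setT f -> (forall v, (0 <= f v)%R) ->
  \int[P]_w (f (X w))%:E = \int[P]_w (f (Y w))%:E.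
Proof.
move=> mX mY XY mf f0.
have mfE : measurable_fun [set: vecm n] (fun v => (f v)%:E : \bar RR).
  exact/measurable_EFinP.
have f0E : {in [set: vecm n], forall v, 0 <= (f v)%:E} by move=> v _; rewrite lee_fin.
have hX := ge0_integral_pushforward (measurable_vec mX) P measurableT mfE f0E.
have hY := ge0_integral_pushforward (measurable_vec mY) P measurableT mfE f0E.
rewrite preimage_setT/= in hX; rewrite preimage_setT/= in hY.
rewrite -hX -hY; apply: eq_measure_integral; [exact: (measurable_vec mY)|exact: (measurable_vec mX)|].
move=> mfY mfX A mA _.
refine (@measure_unique _ RR (vecm n) (@rects n) (fun=> setT) _ _ _ _ _ _ _ _ A _) => //=.
- exact: rectsI.
- by move=> _; exact: rectsT.
- by rewrite bigcup_const//; exists 0%N.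
- by move=> _ [Bs mB <-]; rewrite /= /pushforward; exact: XY.
- by move=> _; rewrite /= /pushforward preimage_setT probability_setT ltry.
Qed.

End SameLaw.

Section Exponential.
Implicit Types x y : RR.

Lemma expR_half_le2 : expR (1 / 2) <= 2 :> RR.
Proof.
have := expR_ge1Dx (- (1 / 2) : RR); have := expRxMexpNx_1 (1 / 2 : RR).
have := expR_gt0 (1 / 2 : RR); nra.
Qed.

Lemma expR1_le4 : expR 1 <= 4 :> RR.
Proof.
have -> : expR 1 = expR (1 / 2) * expR (1 / 2) :> RR by rewrite -exp.expRD; congr expR; lra.
by have := expR_half_le2; have := expR_gt0 (1 / 2 : RR); nra.
Qed.

Lemma sqr_le_expR x : 0 <= x -> x ^+ 2 <= 4 * expR x.
Proof.
move=> x0; have := expR_ge1Dx (x / 2).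
have -> : expR x = expR (x / 2) * expR (x / 2) by rewrite -exp.expRD; congr expR; lra.
have := expR_gt0 (x / 2); nra.
Qed.

(** From (1 - x) exp x <= 1: for x >= 0, multiply by 1 + x; for x < 0, compare with 1 <= (1 + x +
    x^2) (1 - x). *)
Lemma expR_le_quad x : expR x <= 1 + x + x ^+ 2 * expR `|x|.
Proof.
have h1 := expR_ge1Dx (- x); have h2 := expRxMexpNx_1 x; have h3 := expR_gt0 x.
have h5 : (1 - x) * expR x <= 1 by nra.
have [x0|x0] := leP 0 x.
  rewrite ger0_norm//.
  have : ((1 - x) * expR x - 1) * (1 + x) <= 0 by nra.
  by nra.
rewrite ltr0_norm//.
have h4 := expR_ge1Dx (- x).
have h6 : 1 <= (1 + x + x ^+ 2) * (1 - x).
  have -> : (1 + x + x ^+ 2) * (1 - x) = 1 + x ^+ 2 * (- x) by ring.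
  by rewrite lerDl mulr_ge0 ?sqr_ge0//; lra.
have : expR x * (1 - x) <= (1 + x + x ^+ 2) * (1 - x) by lra.
rewrite ler_pM2r; last by lra.
by move=> h; apply: (le_trans h); rewrite lerD2l; nra.
Qed.

(** With e = xi - m, the square of e costs 64 exp(|e| / 4) and exp |l e| another exp(|e| / 4). Their
    exponents add up to at most 1 + |xi|, and exp 1 <= 4 gives 256 = 64 * 4. *)
Lemma expR_mul_le_quad (l xi m : RR) : `|l| <= 1 / 4 -> `|m| <= 2 ->
  expR (l * (xi - m)) <= 1 + l * (xi - m) + 256 * l ^+ 2 * expR `|xi|.
Proof.
move=> l4 m2; apply: (le_trans (expR_le_quad _)); rewrite lerD2l.
set e := xi - m.
have le : `|l * e| <= `|e| / 4 by rewrite normrM mulrC; have := normr_ge0 e; nra.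
have h1 : expR `|l * e| <= expR (`|e| / 4) by rewrite ler_expR.
have h2 : e ^+ 2 <= 64 * expR (`|e| / 4).
  have := @sqr_le_expR (`|e| / 4); rewrite expr_div_n real_normK ?num_real//.
  by have := normr_ge0 e; lra.
have h3 : expR (`|e| / 4) * expR (`|e| / 4) <= 4 * expR `|xi|.
  rewrite -exp.expRD; apply: (@le_trans _ _ (expR (1 + `|xi|))).
    rewrite ler_expR; have := ler_normB xi m; rewrite -/e.
    have := normr_ge0 xi; lra.
  by rewrite exp.expRD ler_wpM2r ?expR_ge0// expR1_le4.
rewrite exprMn.
have l0 := sqr_ge0 l; have e0 := sqr_ge0 e.
have h4 : e ^+ 2 * expR `|l * e| <= 256 * expR `|xi|.
  apply: (@le_trans _ _ (64 * expR (`|e| / 4) * expR (`|e| / 4))).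
    by rewrite ler_pM ?expR_ge0.
  by rewrite -mulrA; lra.
by rewrite -mulrA mulrCA; nra.
Qed.

End Exponential.

Section Mgf.
Context d (T : measurableType d) (P : probability T RR).
Local Open Scope ereal_scope.

Lemma integrable_of_le (f g : T -> RR) : measurable_fun setT f -> measurable_fun setT g ->
  (forall w, `|f w| <= g w)%R -> \int[P]_w (g w)%:E < +oo ->
  P.-integrable setT (fun w => (f w)%:E).
Proof.
move=> mf mg fg goo; apply/integrableP; split; first exact/measurable_EFinP.
apply: le_lt_trans goo; apply: ge0_le_integral => //.
- by apply/measurable_EFinP; exact: measurableT_comp.
- exact/measurable_EFinP.
- by move=> w _; rewrite lee_fin.
Qed.

Lemma integral_prob_cst (r : RR) : \int[P]_w r%:E = r%:E.
Proof.
have := integral_cst P measurableT r%:E.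
have -> : r%:E * P [set: T] = r%:E by rewrite probability_setT mule1.
by [].
Qed.

Variable xi : T -> RR.
Hypotheses (mxi : measurable_fun setT xi) (hxi : \int[P]_w (expR `|xi w|)%:E <= 3%:E).
Local Notation m := (Ex P xi).

Let mexp : measurable_fun setT (fun w => expR `|xi w|).
Proof. by apply: measurableT_comp => //; exact: measurableT_comp. Qed.

Lemma integrable_subexp : P.-integrable setT (fun w => (xi w)%:E).
Proof.
apply: (@integrable_of_le _ (fun w => expR `|xi w|)) => //.
  by move=> w; have := expR_ge1Dx `|xi w|%R; lra.
by apply: le_lt_trans hxi _; rewrite ltry.
Qed.

Lemma integrable_exp_abs : P.-integrable setT (fun w => (expR `|xi w|)%:E).
Proof.
apply: (@integrable_of_le _ (fun w => expR `|xi w|)) => //.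
  by move=> w; rewrite ger0_norm// expR_ge0.
by apply: le_lt_trans hxi _; rewrite ltry.
Qed.

Lemma ExE : \int[P]_w (xi w)%:E = m%:E.
Proof. by rewrite fineK//; exact: integrable_fin_num integrable_subexp. Qed.

(** From |x| <= exp |x| - 1 and 3 - 1 = 2. *)
Lemma norm_mean_le : (`|m| <= 2)%R.
Proof.
have ei := integrable_exp_abs.
have c1 : P.-integrable setT (EFin \o cst 1%R) by exact: finite_measure_integrable_cst.
rewrite -lee_fin -abse_EFin -ExE.
apply: (le_trans (le_abse_integral _ _ _)) => //; first exact/measurable_EFinP.
apply: (@le_trans _ _ (\int[P]_w ((expR `|xi w|)%:E - (cst 1%R w)%:E))).
  apply: ge0_le_integral => //.
  - by apply/measurable_EFinP; exact: measurableT_comp.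
  - by apply/measurable_EFinP; exact: measurable_funB.
  - by move=> w _; rewrite lee_fin/=; have := expR_ge1Dx `|xi w|%R; lra.
rewrite integralB//= integral_prob_cst.
rewrite leeBlDr// -EFinD (le_trans hxi)// lee_fin; lra.
Qed.

(** The linear term has mean 0 and the quadratic one at most 256 * 3 = 768 times l^2, rounded up to
    1024 = 32^2. *)
Lemma mgf_le (l : RR) : (`|l| <= 1 / 4)%R ->
  \int[P]_w (expR (l * (xi w - m)))%:E <= (expR (1024 * l ^+ 2))%:E.
Proof.
move=> l4.
have xi_int := integrable_subexp; have e_int := integrable_exp_abs.
have c_int (c : RR) : P.-integrable setT (EFin \o cst c).
  exact: finite_measure_integrable_cst.
pose f1 w := (l%:E * ((xi w)%:E - (cst m w)%:E)).
pose f2 w := ((256 * l ^+ 2)%:E * (expR `|xi w|)%:E).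
have i0 : P.-integrable setT (fun w => (xi w)%:E - (cst m w)%:E).
  exact: (integrableB measurableT xi_int (c_int m)).
have i1 : P.-integrable setT f1 by exact: integrableZl.
have i2 : P.-integrable setT f2 by exact: integrableZl.
have I1 : \int[P]_w f1 w = 0.
  rewrite integralZl//.
  rewrite integralB//=; last exact: c_int.
  rewrite [X in _ * (X - _)]ExE [X in _ * (_ - X)]integral_prob_cst.
  by rewrite -EFinB subrr mule0.
have I2 : \int[P]_w f2 w <= (768 * l ^+ 2)%:E.
  rewrite integralZl//; apply: (@le_trans _ _ ((256 * l ^+ 2)%:E * 3%:E)).
    by rewrite lee_wpmul2l// lee_fin mulr_ge0// sqr_ge0.
  by rewrite -EFinM lee_fin; lra.
apply: (@le_trans _ _ (\int[P]_w (1%:E + (f1 w + f2 w)))).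
  apply: ge0_le_integral => //.
  - apply/measurable_EFinP; apply: measurableT_comp => //; apply: measurable_funM => //.
    exact: measurable_funB.
  - apply: emeasurable_funD; first exact: measurable_cst.
    by apply: emeasurable_funD; [case/integrableP: i1|case/integrableP: i2].
  - move=> w _; rewrite /f1 /f2/= -EFinB -!EFinM -!EFinD lee_fin addrA.
    by apply: expR_mul_le_quad => //; exact: norm_mean_le.
have i12 : P.-integrable setT (fun w => f1 w + f2 w) by exact: integrableD.
rewrite (integralD _ (c_int 1%R) i12)//= integral_prob_cst.
rewrite integralD// I1 add0e.
apply: (@le_trans _ _ (1 + 768 * l ^+ 2)%:E); first by rewrite EFinD leeD2l.
rewrite lee_fin (le_trans _ (expR_ge1Dx _))// lerD2l.
by have := sqr_ge0 l; lra.
Qed.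

End Mgf.

(** * Concentration of sample averages *)

Section FailsAtMost.
Context d (T : measurableType d) (P : probability T RR).

(** The exceptional set [F] only has to contain the failures of [Q], so [Q] itself may be a
    non-measurable property and union bounds stay available. *)
Definition fails_at_most (p : RR) (Q : T -> Prop) :=
  exists F, [/\ measurable F, (P F <= p%:E)%E & forall w, ~ F w -> Q w].

Lemma fails_le p p' (Q Q' : T -> Prop) : p <= p' -> (forall w, Q w -> Q' w) ->
  fails_at_most p Q -> fails_at_most p' Q'.
Proof.
move=> pp QQ [F [mF PF hF]]; exists F; split => //; last by move=> w /hF /QQ.
by rewrite (le_trans PF)// lee_fin.
Qed.

Lemma fails_and p p' (Q Q' : T -> Prop) : fails_at_most p Q -> fails_at_most p' Q' ->
  fails_at_most (p + p') (fun w => Q w /\ Q' w).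
Proof.
move=> [F [mF PF hF]] [G [mG PG hG]]; exists (F `|` G); split.
- exact: measurableU.
- by rewrite (le_trans (measureU2 _ mF mG))// EFinD leeD.
- by move=> w /not_orP[/hF ? /hG].
Qed.

Lemma fails_all (I : eqType) (s : seq I) p (Q : I -> T -> Prop) :
  (forall i, i \in s -> fails_at_most p (Q i)) ->
  fails_at_most ((size s)%:R * p) (fun w => forall i, i \in s -> Q i w).
Proof.
elim: s => [|i s IH] h.
  by exists set0; split => //; rewrite measure0 mul0r.
have h1 := h i (mem_head _ _).
have h2 := IH (fun j js => h j (mem_behead (s := i :: s) js)).
apply: fails_le (fails_and h1 h2); first by rewrite /= -natr1 mulrDl mul1r addrC.
by move=> w [Qi Qs] j; rewrite inE => /orP[/eqP ->|/Qs].
Qed.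

End FailsAtMost.

Section Concentration.
Context d (T : measurableType d) (P : probability T RR) (n N : nat).
Local Notation V := (vecm n).
Variables (X : T -> 'cV[RR]_n) (Xs : 'I_N -> T -> 'cV[RR]_n).
Hypotheses (mX : rvec_measurable X) (mXs : forall i, rvec_measurable (Xs i)).
Hypotheses (lXs : forall i, same_law P (Xs i) X) (iXs : mutually_independent P Xs).

Section Tail.
Variable g : V -> RR.
Hypotheses (mg : measurable_fun setT g) (hg : (\int[P]_w (expR `|g (X w)|)%:E <= 3%:E)%E).
Local Notation m := (Ex P (g \o X)).

Lemma measurable_sample i : measurable_fun setT (fun w => g (Xs i w)).
Proof. exact: (measurableT_comp mg (measurable_vec (mXs i))). Qed.

(** Chernoff's method: Markov's inequality at level exp(2 t), while the product of the N exponential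
    moments is at most exp t. The sign of [l] selects the tail. *)
Lemma mean_tail (l t : RR) : `|l| <= 1 / 4 -> 1024 * N%:R * l ^+ 2 <= t ->
  (P [set w | (2 * t <= l * \sum_i (g (Xs i w) - m))%R] <= (expR (- t))%:E)%E.
Proof.
move=> l4 lt.
pose f (v : V) := expR (l * (g v - m)).
have mf : measurable_fun [set: V] f.
  apply: measurableT_comp => //; apply: measurable_funM => //.
  exact: measurable_funB.
have f0 v : 0 <= f v by exact: expR_ge0.
have mgX : measurable_fun setT (g \o X) by exact: (measurableT_comp mg (measurable_vec mX)).
have hf := mgf_le mgX hg l4.
have If0 : (0 <= \int[P]_w (f (X w))%:E)%E by apply: integral_ge0 => w _; rewrite lee_fin.
have : (\int[P]_w (f (X w))%:E \is a fin_num)%E.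
  by rewrite ge0_fin_numE//; apply: le_lt_trans hf _; rewrite ltry.
move=> /fineK; set a := fine _ => aE.
have a0 : 0 <= a by rewrite -lee_fin aE.
have al : a <= expR (1024 * l ^+ 2) by rewrite -lee_fin aE.
have IfE i : (\int[P]_w (f (Xs i w))%:E = a%:E)%E.
  by rewrite aE; apply: same_law_integral.
have prodE : (\int[P]_w (\prod_i f (Xs i w))%:E = (a ^+ N)%:E)%E.
  rewrite (integral_prod_indep mXs iXs (f := fun=> f)).
    under eq_bigr do rewrite IfE.
    by rewrite prodEFin prodr_const card_ord.
  by move=> i; split => //; rewrite IfE ltry.
have aN : a ^+ N <= expR t.
  apply: (@le_trans _ _ (expR (1024 * l ^+ 2) ^+ N)).
    by rewrite lerXn2r ?nnegrE ?expR_ge0.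
  by rewrite -expRM_natl ler_expR; nra.
set A := [set w | _].
have mSum : measurable_fun setT (fun w => l * \sum_i (g (Xs i w) - m)).
  apply: measurable_funM => //; apply: measurable_sum => i _.
  by apply: measurable_funB => //; exact: measurable_sample.
have mA : measurable A.
  by have := measurable_fun_le measurableT (measurable_cst (2 * t)) mSum; rewrite setTI.
have mprod : measurable_fun setT (fun w => \prod_i f (Xs i w)).
  apply: measurable_prod => i _.
  exact: (measurableT_comp mf (measurable_vec (mXs i))).
have h1 : ((expR (2 * t))%:E * P A <= \int[P]_w (\prod_i f (Xs i w))%:E)%E.
  have <- := integral_cst P mA (expR (2 * t))%:E.
  apply: (@le_trans _ _ (\int[P]_(w in A) (\prod_i f (Xs i w))%:E)%E).
    apply: ge0_le_integral => //.
    - by move=> w _; rewrite lee_fin expR_ge0.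
    - by apply/measurable_EFinP; exact: measurable_funTS.
    - move=> w /= wA; rewrite lee_fin /f.
      by rewrite -expR_sum ler_expR -mulr_sumr.
  apply: ge0_subset_integral => //; first exact/measurable_EFinP.
  by move=> w _; rewrite lee_fin prodr_ge0.
rewrite -(@lee_pmul2l _ (expR (2 * t))%:E)//; last by rewrite lte_fin expR_gt0.
apply: (le_trans h1); rewrite prodE -EFinM lee_fin -exp.expRD.
by apply: (le_trans aN); rewrite ler_expR; lra.
Qed.

End Tail.
End Concentration.

(** * Sub-Gaussian variables at an explicit scale *)

Section SubGaussian.
Context d (T : measurableType d) (P : probability T RR).
Implicit Types Z W : T -> RR.

Definition subg (a : RR) Z := 0 < a /\ (\int[P]_w (expR ((Z w / a) ^+ 2))%:E <= 2%:E)%E.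

Lemma measurable_sqr_exp a Z : measurable_fun setT Z ->
  measurable_fun setT (fun w => expR ((Z w / a) ^+ 2)).
Proof.
move=> mZ; apply: measurableT_comp => //; apply: measurable_funX.
exact: measurable_funM.
Qed.

(** Common majorant: the integrability and moment bounds below dominate their integrand pointwise by
    such a combination. *)
Lemma integral_sqr_exp_comb (a b x y z : RR) Z W :
  measurable_fun setT Z -> measurable_fun setT W -> subg a Z -> subg b W ->
  0 <= x -> 0 <= y -> 0 <= z ->
  (\int[P]_w (z + (x * expR ((Z w / a) ^+ 2) + y * expR ((W w / b) ^+ 2)))%:E
    <= (z + (2 * x + 2 * y))%:E)%E.
Proof.
move=> mZ mW [a0 hZ] [b0 hW] x0 y0 z0.
have mA := measurable_sqr_exp a mZ; have mB := measurable_sqr_exp b mW.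
under eq_integral do rewrite EFinD.
rewrite ge0_integralD//; last 2 first.
- by move=> w _; rewrite lee_fin addr_ge0// mulr_ge0// expR_ge0.
- by apply/measurable_EFinP; apply: measurable_funD; exact: measurable_funM.
rewrite EFinD; apply: leeD; first by rewrite [leLHS]integral_prob_cst.
under eq_integral do rewrite EFinD.
rewrite ge0_integralD//; last 4 first.
- by move=> w _; rewrite lee_fin mulr_ge0// expR_ge0.
- by apply/measurable_EFinP; exact: measurable_funM.
- by move=> w _; rewrite lee_fin mulr_ge0// expR_ge0.
- by apply/measurable_EFinP; exact: measurable_funM.
have scal c V v : 0 <= c -> measurable_fun setT (fun w => expR ((V w / v) ^+ 2)) ->
    (\int[P]_w (expR ((V w / v) ^+ 2))%:E <= 2%:E)%E ->
    (\int[P]_w (c * expR ((V w / v) ^+ 2))%:E <= (2 * c)%:E)%E.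
  move=> c0 mV hV; under eq_integral do rewrite EFinM.
  rewrite ge0_integralZl_EFin//; last exact/measurable_EFinP.
  by rewrite mulrC EFinM lee_wpmul2l// lee_fin.
by rewrite EFinD leeD// scal.
Qed.

(** exp |p q| <= exp(p^2 / 2) exp(q^2 / 2), at most the mean of exp(p^2) and exp(q^2). This gives 2;
    the constant 3 is the one [subexp_lin] reaches, so that both feed the same tail bound. *)
Lemma subexp_mul a b Z W : measurable_fun setT Z -> measurable_fun setT W ->
  subg a Z -> subg b W ->
  (\int[P]_w (expR `|Z w * W w / (a * b)|)%:E <= 3%:E)%E.
Proof.
move=> mZ mW hZ hW; have [[a0 _] [b0 _]] := (hZ, hW).
apply: (le_trans (_ : _ <= \int[P]_w (0 + (1 / 2 * expR ((Z w / a) ^+ 2) + 1 / 2 * expR ((W w / b) ^+ 2)))%:E)%E).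
  apply: ge0_le_integral => //.
  - by apply/measurable_EFinP; do 2 apply: measurableT_comp => //; do 2 apply: measurable_funM => //.
  - apply/measurable_EFinP; apply: measurable_funD => //.
    by apply: measurable_funD; apply: measurable_funM => //; exact: measurable_sqr_exp.
  - move=> w _; rewrite lee_fin add0r.
    have -> : Z w * W w / (a * b) = (Z w / a) * (W w / b) by rewrite invfM mulrACA.
    move: (Z w / a) (W w / b) => p q; rewrite normrM.
    have h : `|p| * `|q| <= p ^+ 2 / 2 + q ^+ 2 / 2.
      rewrite -(real_normK (num_real p)) -(real_normK (num_real q)).
      have := sqr_ge0 (`|p| - `|q|); lra.
    apply: (@le_trans _ _ (expR (p ^+ 2 / 2) * expR (q ^+ 2 / 2))).
      by rewrite -exp.expRD ler_expR.
    have e2 (x : RR) : expR x = expR (x / 2) ^+ 2 by rewrite expr2 -exp.expRD; congr expR; lra.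
    rewrite (e2 (p ^+ 2)) (e2 (q ^+ 2)).
    have := sqr_ge0 (expR (p ^+ 2 / 2) - expR (q ^+ 2 / 2)); lra.
apply: (le_trans (integral_sqr_exp_comb mZ mW hZ hW _ _ _)); rewrite ?lee_fin; lra.
Qed.

(** |p| <= 1/2 + p^2 / 2 and exp(1/2) <= 2 give exp |p| <= 2 exp(p^2 / 2) <= 1 + exp(p^2), of mean
    at most 3. *)
Lemma subexp_lin a Z : measurable_fun setT Z -> subg a Z ->
  (\int[P]_w (expR `|Z w / a|)%:E <= 3%:E)%E.
Proof.
move=> mZ hZ; have [a0 _] := hZ.
apply: (le_trans (_ : _ <= \int[P]_w (1 + (1 * expR ((Z w / a) ^+ 2) + 0 * expR ((Z w / a) ^+ 2)))%:E)%E).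
  apply: ge0_le_integral => //.
  - by apply/measurable_EFinP; do 2 apply: measurableT_comp => //; apply: measurable_funM => //.
  - apply/measurable_EFinP; apply: measurable_funD => //.
    by apply: measurable_funD; apply: measurable_funM => //; exact: measurable_sqr_exp.
  - move=> w _; rewrite lee_fin mul0r addr0 mul1r; move: (Z w / a) => p.
    apply: (@le_trans _ _ (expR (1 / 2 + p ^+ 2 / 2))).
      rewrite ler_expR -(real_normK (num_real p)).
      have := sqr_ge0 (`|p| - 1); lra.
    rewrite exp.expRD.
    have -> : expR (p ^+ 2) = expR (p ^+ 2 / 2) * expR (p ^+ 2 / 2).
      by rewrite -exp.expRD; congr expR; lra.
    have := expR_half_le2; have := expR_gt0 (1 / 2 : RR); have := expR_gt0 (p ^+ 2 / 2).
    move: (expR (1 / 2)) (expR (p ^+ 2 / 2)) => c e e0 c0 c2.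
    have := sqr_ge0 (e - 1); nra.
apply: (le_trans (integral_sqr_exp_comb mZ mZ hZ hZ _ _ _)); rewrite ?lee_fin; lra.
Qed.

Lemma subg_integrable a Z : measurable_fun setT Z -> subg a Z ->
  P.-integrable setT (fun w => (Z w)%:E).
Proof.
move=> mZ hZ; have [a0 _] := hZ.
apply: (@integrable_of_le _ _ _ _ (fun w => 0 + (a * expR ((Z w / a) ^+ 2) + 0 * expR ((Z w / a) ^+ 2)))) => //.
- apply: measurable_funD => //.
  by apply: measurable_funD; apply: measurable_funM => //; exact: measurable_sqr_exp.
- move=> w; rewrite add0r mul0r addr0.
  have {1}-> : Z w = a * (Z w / a) by rewrite mulrC divfK ?lt0r_neq0.
  rewrite normrM (gtr0_norm a0) ler_wpM2l ?(ltW a0)//; move: (Z w / a) => p.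
  apply: (le_trans _ (expR_ge1Dx _)); rewrite -(real_normK (num_real p)).
  have := sqr_ge0 (`|p| - 1 / 2); lra.
- apply: (le_lt_trans (integral_sqr_exp_comb mZ mZ hZ hZ _ _ _)); rewrite ?ltry//; lra.
Qed.

Lemma subg_integrableM a b Z W : measurable_fun setT Z -> measurable_fun setT W ->
  subg a Z -> subg b W -> P.-integrable setT (fun w => (Z w * W w)%:E).
Proof.
move=> mZ mW hZ hW; have [[a0 _] [b0 _]] := (hZ, hW).
have ab0 : 0 < a * b by rewrite mulr_gt0.
apply: (@integrable_of_le _ _ _ _ (fun w => 0 + (a * b * expR ((Z w / a) ^+ 2) + a * b * expR ((W w / b) ^+ 2)))) => //.
- exact: measurable_funM.
- apply: measurable_funD => //.
  by apply: measurable_funD; apply: measurable_funM => //; exact: measurable_sqr_exp.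
- move=> w; rewrite add0r -mulrDr.
  have -> : Z w * W w = (a * b) * ((Z w / a) * (W w / b)).
    by rewrite mulrACA !(mulrC _ (_ / _)) !divfK ?lt0r_neq0.
  rewrite normrM (gtr0_norm ab0) ler_wpM2l ?(ltW ab0)//.
  move: (Z w / a) (W w / b) => p q; rewrite normrM.
  have := expR_ge1Dx (p ^+ 2); have := expR_ge1Dx (q ^+ 2).
  rewrite -{1}(real_normK (num_real p)) -{1}(real_normK (num_real q)).
  have := sqr_ge0 (`|p| - `|q|); have := sqr_ge0 (`|p|); have := sqr_ge0 (`|q|); lra.
- apply: (le_lt_trans (integral_sqr_exp_comb mZ mW hZ hW _ _ _)); rewrite ?ltry//; lra.
Qed.

Lemma Ex_sum (I : finType) (c : I -> RR) (f : I -> T -> RR) :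
  (forall i, P.-integrable setT (fun w => (f i w)%:E)) ->
  P.-integrable setT (fun w => (\sum_i c i * f i w)%:E) /\
  Ex P (fun w => \sum_i c i * f i w) = \sum_i c i * Ex P (f i).
Proof.
move=> fi.
have cf i : P.-integrable setT (fun w => (c i)%:E * (f i w)%:E)%E by exact: integrableZl.
have E w : (\sum_i c i * f i w)%:E = (\sum_i (c i)%:E * (f i w)%:E)%E by rewrite -sumEFin.
have fin i : (\int[P]_w (f i w)%:E)%E = (Ex P (f i))%:E.
  by rewrite fineK//; exact: integrable_fin_num (fi i).
split; first by under eq_fun do rewrite E; exact: integrable_sum.
rewrite /Ex; under eq_integral do rewrite E.
rewrite integral_sum//.
have -> : (\sum_i \int[P]_w ((c i)%:E * (f i w)%:E) = \sum_i (c i * Ex P (f i))%:E)%E.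
  by apply: eq_bigr => i _; rewrite integralZl// EFinM -fin.
by rewrite sumEFin.
Qed.

End SubGaussian.

Section SampleCov.
Variables (n N : nat).
Hypothesis N0 : (0 < N)%N.
Let Nr0 : N%:R != 0 :> RR. Proof. by rewrite pnatr_eq0 -lt0n. Qed.

(** The centre [mu] is arbitrary. At the true mean, all sums have independent terms and the effect
    of the sample mean is a product of two small averages. *)
Lemma sample_cov_dot (xs : 'I_N -> 'cV[RR]_n) (a b mu : 'cV[RR]_n) :
  dot a (sample_cov xs *m b) =
  N%:R^-1 * (\sum_i dot a (xs i - mu) * dot b (xs i - mu)) -
  (N%:R^-1 * \sum_i dot a (xs i - mu)) * (N%:R^-1 * \sum_i dot b (xs i - mu)).
Proof.
set xb := sample_mean xs.
have dot_sum u : N%:R^-1 * \sum_i dot u (xs i - mu) = dot u (xb - mu).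
  rewrite /dot mulmxBr mxE [X in _ + X]mxE /xb /sample_mean -scalemxAr mxE mulmx_sumr summxE.
  under eq_bigr do rewrite mulmxBr mxE [X in _ + X]mxE.
  by rewrite sumrB sumr_const card_ord mulrBr -[X in _ - _ * X]mulr_natl mulKf.
have dotB u v w : dot u (v - w) = dot u v - dot u w by rewrite dotDr dotNr.
have -> : dot a (sample_cov xs *m b) = N%:R^-1 * \sum_i dot a (xs i - xb) * dot b (xs i - xb).
  rewrite /sample_cov -scalemxAl dotZr mulmx_suml; congr (_ * _).
  rewrite /dot mulmx_sumr summxE; apply: eq_bigr => i _.
  rewrite -(mulmxA _ _ b) mulmxA mxE big_ord1; congr (_ * _).
  by rewrite -/(dot _ _) dotC.
rewrite !dot_sum.
have E i : dot a (xs i - xb) * dot b (xs i - xb) =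
   dot a (xs i - mu) * dot b (xs i - mu) - dot b (xb - mu) * dot a (xs i - mu)
   - dot a (xb - mu) * dot b (xs i - mu) + dot a (xb - mu) * dot b (xb - mu).
  by rewrite !dotB; ring.
under eq_bigr do rewrite E.
rewrite big_split/= sumrB sumrB -!mulr_sumr sumr_const card_ord.
have hs u : \sum_i dot u (xs i - mu) = N%:R * dot u (xb - mu) by rewrite -dot_sum mulVKf.
by rewrite !hs -mulr_natl; field.
Qed.

End SampleCov.

(* Sealed behind an opaque proof: conversion must never unfold the unary numeral. *)
Lemma cov_const_subproof : {c : RR | 4160 <= c}.
Proof. by exists 4160. Qed.

Definition cov_const : RR := sval cov_const_subproof.

Lemma cov_const_ge : 4160 <= cov_const.
Proof. exact: (svalP cov_const_subproof). Qed.

Lemma cov_const_gt0 : 0 < cov_const.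
Proof. by have := cov_const_ge; lra. Qed.

Section Concentration.
Context d (T : measurableType d) (P : probability T RR) (n N : nat).
Local Notation V := (vecm n).
Variables (X : T -> 'cV[RR]_n) (Xs : 'I_N -> T -> 'cV[RR]_n).
Hypotheses (mX : rvec_measurable X) (mXs : forall i, rvec_measurable (Xs i)).
Hypotheses (lXs : forall i, same_law P (Xs i) X) (iXs : mutually_independent P Xs).
Hypothesis N0 : (0 < N)%N.
Let Nr0 : 0 < N%:R :> RR. Proof. by rewrite ltr0n. Qed.

(** [mean_tail] at l = q / 32 and l = - q / 32 with q = sqrt(t / N): then 1024 N l^2 = t and 2 t /
    |l| = 64 N q. The bound t <= N gives q <= 1, which keeps |l| below 1/4. *)
Lemma mean_concentration (g : V -> RR) t : measurable_fun setT g ->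
  (\int[P]_w (expR `|g (X w)|)%:E <= 3%:E)%E -> 0 < t -> t <= N%:R ->
  fails_at_most P (2 * expR (- t)) (fun w =>
    `|N%:R^-1 * \sum_i g (Xs i w) - Ex P (g \o X)| <= 64 * Num.sqrt (t / N%:R)).
Proof.
move=> mg hg t0 tN; set q := Num.sqrt _; set m := Ex _ _.
have q2 : N%:R * q ^+ 2 = t by rewrite sqr_sqrtr ?divr_ge0 ?ltW// mulrC divfK// lt0r_neq0.
have q0 : 0 < q by rewrite sqrtr_gt0 divr_gt0.
have q1 : q <= 1 by rewrite -sqrtr1 ler_wsqrtr// ler_pdivrMr// mul1r.
pose A l := [set w | 2 * t <= l * \sum_i (g (Xs i w) - m)].
have mA l : measurable (A l).
  have mS : measurable_fun setT (fun w => l * \sum_i (g (Xs i w) - m)).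
    apply: measurable_funM => //; apply: measurable_sum => i _.
    by apply: measurable_funB => //; exact: (measurable_sample mXs mg).
  by have := measurable_fun_le measurableT (measurable_cst (2 * t)) mS; rewrite setTI.
have pA l : `|l| = q / 32 -> (P (A l) <= (expR (- t))%:E)%E.
  move=> lq; apply: (mean_tail mX mXs lXs iXs mg hg).
    by rewrite lq; lra.
  by rewrite -(real_normK (num_real l)) lq -q2; lra.
exists (A (q / 32) `|` A (- (q / 32))); split; first exact: measurableU.
  rewrite (le_trans (measureU2 _ (mA _) (mA _)))// mulrDl mul1r EFinD.
  by rewrite leeD// pA ?normrN// ger0_norm//; lra.
move=> w /not_orP[h1 h2].
have {h1} : q / 32 * \sum_i (g (Xs i w) - m) < 2 * t by rewrite ltNge; apply/negP.
have {h2} : - (q / 32) * \sum_i (g (Xs i w) - m) < 2 * t by rewrite ltNge; apply/negP.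
rewrite sumrB sumr_const card_ord -mulr_natr -{}q2.
move: (\sum_i _) => S h1 h2.
have -> : N%:R^-1 * S - m = N%:R^-1 * (S - m * N%:R).
  by rewrite mulrBr (mulrC m) mulKf// lt0r_neq0.
rewrite normrM gtr0_norm ?invr_gt0// ler_pdivrMl// ler_norml.
by apply/andP; split; rewrite -(ler_pM2l q0); lra.
Qed.

Variables (mu : 'cV[RR]_n).

Lemma measurable_dot (a : 'cV[RR]_n) : measurable_fun setT (fun v : V => dot a (v - mu)).
Proof.
under eq_fun do rewrite dotE.
apply: measurable_sum => i _; apply: measurable_funM => //.
under eq_fun do rewrite mxE.
by apply: measurable_funD; [exact: measurable_coord|exact: measurable_cst].
Qed.

Lemma measurable_dotX (a : 'cV[RR]_n) (Y : T -> 'cV[RR]_n) : rvec_measurable Y ->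
  measurable_fun setT (fun w => dot a (Y w - mu)).
Proof.
by move=> mY; exact: (measurableT_comp (measurable_dot a) (measurable_vec mY)).
Qed.

Variables (Sig : 'M[RR]_n).
Hypothesis mean0 : forall a, Ex P (fun w => dot a (X w - mu)) = 0.
Hypothesis SigE : forall a b,
  dot a (Sig *m b) = Ex P (fun w => dot a (X w - mu) * dot b (X w - mu)).

Lemma Ex_div (f : T -> RR) c : P.-integrable setT (fun w => (f w)%:E) ->
  Ex P (fun w => f w / c) = Ex P f / c.
Proof.
move=> fi; rewrite /Ex; under eq_integral do rewrite EFinM.
by rewrite integralZr// fineM// integrable_fin_num.
Qed.

Lemma cov_scalar (a b : 'cV[RR]_n) (al be t : RR) : 0 < t -> t <= N%:R ->
  subg P al (fun w => dot a (X w - mu)) -> subg P be (fun w => dot b (X w - mu)) ->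
  fails_at_most P (6 * expR (- t)) (fun w =>
    `|dot a ((sample_cov (fun i => Xs i w) - Sig) *m b)| <=
      cov_const * (al * be) * Num.sqrt (t / N%:R)).
Proof.
move=> t0 tN sa sb; have [[al0 _] [be0 _]] := (sa, sb).
have ab0 : 0 < al * be by rewrite mulr_gt0.
have ma := measurable_dotX a mX; have mb := measurable_dotX b mX.
pose g1 (v : V) := dot a (v - mu) * dot b (v - mu) / (al * be).
pose g2 (c : RR) u (v : V) := dot u (v - mu) / c.
have mg1 : measurable_fun setT g1.
  by apply: measurable_funM => //; apply: measurable_funM; exact: measurable_dot.
have mg2 c u : measurable_fun setT (g2 c u).
  by apply: measurable_funM => //; exact: measurable_dot.
(* One average for the product and one for each factor of the sample-mean correction, each failing
   with probability at most 2 exp(- t). *)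
have h1 := mean_concentration mg1 (subexp_mul ma mb sa sb) t0 tN.
have h2 := mean_concentration (mg2 al a) (subexp_lin ma sa) t0 tN.
have h3 := mean_concentration (mg2 be b) (subexp_lin mb sb) t0 tN.
apply: fails_le (fails_and h1 (fails_and h2 h3)).
  by have := expR_gt0 (- t); lra.
move=> w; set q := Num.sqrt _.
have E1 : Ex P (g1 \o X) = dot a (Sig *m b) / (al * be).
  by rewrite SigE -Ex_div//; exact: (subg_integrableM ma mb sa sb).
have E2 : Ex P (g2 al a \o X) = 0.
  by have := Ex_div al (subg_integrable ma sa); rewrite mean0 mul0r.
have E3 : Ex P (g2 be b \o X) = 0.
  by have := Ex_div be (subg_integrable mb sb); rewrite mean0 mul0r.
rewrite E1 E2 E3 !subr0 /g1 /g2 -!mulr_suml.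
rewrite mulmxBl dotDr dotNr (sample_cov_dot N0 _ _ _ mu).
set S1 := \sum_i _; set S2 := \sum_i _; set S3 := \sum_i _.
move: (dot a _) => s [k1 [k2 k3]].
have q0 : 0 <= q by exact: sqrtr_ge0.
have q1 : q <= 1 by rewrite -sqrtr1 ler_wsqrtr// ler_pdivrMr// mul1r.
have al1 : al != 0 by rewrite lt0r_neq0.
have be1 : be != 0 by rewrite lt0r_neq0.
have N1 : N%:R != 0 :> RR by rewrite lt0r_neq0.
have -> : N%:R^-1 * S1 - N%:R^-1 * S2 * (N%:R^-1 * S3) - s =
  (al * be) * ((N%:R^-1 * (S1 / (al * be)) - s / (al * be)) -
    (N%:R^-1 * (S2 / al)) * (N%:R^-1 * (S3 / be))).
  by field; rewrite al1 be1 N1.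
rewrite normrM gtr0_norm// (mulrC cov_const) -(mulrA (al * be)) ler_pM2l//.
rewrite (le_trans (ler_normB _ _))// normrM.
have h : `|N%:R^-1 * (S2 / al)| * `|N%:R^-1 * (S3 / be)| <= (64 * q) * (64 * q).
  by rewrite ler_pM.
(* 4160 = 64 + 64^2, where q <= 1 turns the squared term into a linear one. *)
apply: (le_trans (lerD k1 h)); apply: (@le_trans _ _ (4160 * q)); first by nra.
by rewrite ler_wpM2r// cov_const_ge.
Qed.

End Concentration.

(** * Concentration of the sample covariance *)

Section CovOpBound.
Context d (T : measurableType d) (P : probability T RR) (n N : nat).
Local Notation V := (vecm n).
Variables (X : T -> 'cV[RR]_n) (Xs : 'I_N -> T -> 'cV[RR]_n).
Hypotheses (mX : rvec_measurable X) (mXs : forall i, rvec_measurable (Xs i)).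
Hypotheses (lXs : forall i, same_law P (Xs i) X) (iXs : mutually_independent P Xs).
Hypothesis N0 : (0 < N)%N.
Variables (mu : 'cV[RR]_n) (Sig : 'M[RR]_n).
Hypothesis mean0 : forall a, Ex P (fun w => dot a (X w - mu)) = 0.
Hypothesis SigE : forall a b,
  dot a (Sig *m b) = Ex P (fun w => dot a (X w - mu) * dot b (X w - mu)).

Lemma cov_op_bound d1 d2 (M1 : 'M[RR]_(d1, n)) (M2 : 'M[RR]_(d2, n)) (r : nat) (al be t : RR) :
  (\rank M1 <= r)%N -> (\rank M2 <= r)%N -> (0 < r)%N -> 0 < al -> 0 < be ->
  (forall v, eucl_norm v <= 1 -> subg P al (fun w => dot (M1^T *m v) (X w - mu))) ->
  (forall v, eucl_norm v <= 1 -> subg P be (fun w => dot (M2^T *m v) (X w - mu))) ->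
  0 < t -> t <= N%:R ->
  fails_at_most P (2 ^+ (36 * r) * (6 * expR (- t))) (fun w =>
    op_bound (M1 *m (sample_cov (fun i => Xs i w) - Sig) *m M2^T)
      (2 * cov_const * (al * be) * Num.sqrt (t / N%:R))).
Proof.
move=> r1 r2 r0 al0 be0 s1 s2 t0 tN.
have [k [U [kr UU MU]]] := orthonormal_factor M1.
have [l [W [lr WW MW]]] := orthonormal_factor M2.
set L1 := U^T *m M1 in MU; set L2 := W^T *m M2 in MW.
have [n1 [z1 b1 c1]] := ball_net (leq_trans kr r1) r0.
have [n2 [z2 b2 c2]] := ball_net (leq_trans lr r2) r0.
set c := cov_const * (al * be) * Num.sqrt (t / N%:R).
have c0 : 0 <= c.
  by rewrite mulr_ge0 ?sqrtr_ge0// mulr_ge0 ?(ltW cov_const_gt0)// mulr_ge0// ltW.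
have h := @fails_all _ _ P _ [seq (x, y) | x <- n1, y <- n2] (6 * expR (- t))
  (fun p w => `|dot (L1^T *m p.1) ((sample_cov (fun i => Xs i w) - Sig) *m (L2^T *m p.2))| <= c).
apply: fails_le (h _).
- rewrite ler_wpM2r ?mulr_ge0 ?expR_ge0// size_allpairs natrM.
  have -> : (36 * r = 18 * r + 18 * r)%N by rewrite -mulnDl.
  by rewrite exprD ler_pM// -natrX ler_nat.
- move=> w hw.
  have hL : op_bound (L1 *m (sample_cov (fun i => Xs i w) - Sig) *m L2^T) (2 * c).
    apply: (@net_op_bound _ _ _ n1 n2) => // x y xn yn.
    have := hw (x, y); rewrite allpairs_f// => /(_ erefl).
    have -> : L1 *m (sample_cov (fun i => Xs i w) - Sig) *m L2^T *m y =
      L1 *m ((sample_cov (fun i => Xs i w) - Sig) *m (L2^T *m y)) by rewrite !mulmxA.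
    by rewrite (dot_mulr x L1); apply: le_trans; exact: ler_norm.
  have oU : op_bound U 1 by move=> v; rewrite eucl_norm_tr_mul// mul1r.
  have oW : op_bound W 1 by move=> v; rewrite eucl_norm_tr_mul// mul1r.
  rewrite MU MW trmx_mul.
  have := op_bound_mul ler01 oU (op_bound_mul (mulr_ge0 (ler0n _ 2) c0) hL (op_boundT ler01 oW)).
  rewrite mul1r mulr1 !mulmxA; apply: op_bound_le.
  by rewrite /c -!mulrA.
move=> [x y] /allpairsP[[x' y'] /= [xn yn [-> ->]]].
apply: (cov_scalar mX mXs lXs iXs N0 mean0 SigE t0 tN).
  (* L1^T x = M1^T (U x) with [U] an isometry, so the scale of [M1] is inherited. *)
  rewrite /L1 trmx_mul trmxK -mulmxA; apply: s1.
  by rewrite eucl_norm_tr_mul// b1.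
rewrite /L2 trmx_mul trmxK -mulmxA; apply: s2.
by rewrite eucl_norm_tr_mul// b2.
Qed.

End CovOpBound.

(** * Psi_2 norms, second moments and centring *)

Section Psi2.
Context d (T : measurableType d) (P : probability T RR).
Implicit Types Z W : T -> RR.

Lemma subg_le a b Z W : measurable_fun setT Z -> measurable_fun setT W -> 0 < b ->
  (forall w, `|Z w / b| <= `|W w / a|) -> subg P a W -> subg P b Z.
Proof.
move=> mZ mW b0 h [a0 hW]; split => //; apply: le_trans hW.
apply: ge0_le_integral => //.
- by apply/measurable_EFinP; exact: measurable_sqr_exp.
- by apply/measurable_EFinP; exact: measurable_sqr_exp.
- move=> w _; rewrite lee_fin ler_expR -(real_normK (num_real (Z w / b))).
  by rewrite -(real_normK (num_real (W w / a))) lerXn2r ?nnegrE.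
Qed.

(** Strictness yields an admissible scale s < a, and enlarging the scale decreases the integral. *)
Lemma psi2_subg a Z : measurable_fun setT Z -> (psi2 P Z < a%:E)%E -> subg P a Z.
Proof.
move=> mZ /ereal_inf_lt[_ [s [s0 hs] <-]]; rewrite lte_fin => sa.
have hs' : subg P s Z.
  split => //; apply: le_trans hs; rewrite le_eqVlt; apply/orP; left; apply/eqP.
  by apply: eq_integral => w _; rewrite real_normK ?num_real.
have a0 := lt_trans s0 sa.
apply: subg_le hs' => // w; rewrite !normrM ler_wpM2l// !gtr0_norm ?invr_gt0//.
by rewrite lef_pV2 ?ltW.
Qed.

Lemma subg_psi2 a Z : subg P a Z -> (psi2 P Z <= a%:E)%E.
Proof.
move=> [a0 ha]; apply: ereal_inf_lbound; exists a => //; split => //.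
apply: le_trans ha; rewrite le_eqVlt; apply/orP; left; apply/eqP.
by apply: eq_integral => w _; rewrite real_normK ?num_real.
Qed.

Lemma subg0 a : 0 < a -> subg P a (fun=> 0).
Proof.
move=> a0; split => //; under eq_integral do rewrite mul0r expr0n exp.expR0.
by rewrite [leLHS]integral_prob_cst lee_fin; lra.
Qed.

(** Integrate 1 + (Z / a)^2 <= exp((Z / a)^2). *)
Lemma subg_moment2 a Z : measurable_fun setT Z -> subg P a Z ->
  Ex P (fun w => Z w * Z w) <= a ^+ 2.
Proof.
move=> mZ hZ; have [a0 h] := hZ.
have iZ := subg_integrableM mZ mZ hZ hZ.
have E : (\int[P]_w (Z w * Z w)%:E = (Ex P (fun w => Z w * Z w))%:E)%E.
  by rewrite fineK//; exact: integrable_fin_num iZ.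
have : (1%:E + (a ^- 2)%:E * \int[P]_w (Z w * Z w)%:E <= 2%:E)%E.
  apply: le_trans h.
  have -> : (1%:E + (a ^- 2)%:E * \int[P]_w (Z w * Z w)%:E =
      \int[P]_w (1 + a ^- 2 * (Z w * Z w))%:E)%E.
    under [RHS]eq_integral do rewrite EFinD.
    rewrite ge0_integralD//; last 2 first.
    - by move=> w _; rewrite lee_fin mulr_ge0 ?invr_ge0 ?sqr_ge0// -expr2 sqr_ge0.
    - apply/measurable_EFinP; apply: measurable_funM => //; exact: measurable_funM.
    congr (_ + _)%E; first by rewrite [RHS]integral_prob_cst.
    under [RHS]eq_integral do rewrite EFinM.
    by rewrite integralZl.
  apply: ge0_le_integral => //.
  - by move=> w _; rewrite lee_fin addr_ge0// mulr_ge0 ?invr_ge0 ?sqr_ge0// -expr2 sqr_ge0.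
  - apply/measurable_EFinP; apply: measurable_funD => //; apply: measurable_funM => //.
    exact: measurable_funM.
  - by apply/measurable_EFinP; exact: measurable_sqr_exp.
  - move=> w _; rewrite lee_fin; apply: (le_trans _ (expR_ge1Dx _)).
    by rewrite lerD2l exprMn exprVn mulrC -expr2.
rewrite E -EFinM -EFinD lee_fin => h2.
have : a ^- 2 * Ex P (fun w => Z w * Z w) <= 1 by lra.
by rewrite ler_pdivrMl ?exprn_gt0// mulr1.
Qed.

(* Weighted sum of the tangent-line inequalities of exp at th * z, taken at z and at 0. *)
Lemma expR_convex (th z : RR) : 0 <= th -> th <= 1 ->
  expR (th * z) <= (1 - th) + th * expR z.
Proof.
move=> h0 h1; set e := expR (th * z).
have e0 : 0 < e by exact: expR_gt0.
have a1 : e * (1 + (1 - th) * z) <= expR z.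
  have -> : expR z = e * expR ((1 - th) * z) by rewrite -exp.expRD; congr expR; ring.
  by rewrite ler_pM2l// expR_ge1Dx.
have a2 : e * (1 - th * z) <= 1.
  have h2 : e * expR (- (th * z)) = 1 := expRxMexpNx_1 _.
  by rewrite -[leRHS]h2 ler_pM2l// expR_ge1Dx.
nra.
Qed.

(** With y = Z / a and a mean m of size at most 2, ((y - m) / 32)^2 <= (y^2 + 4) / 512. Convexity
    with weight 1/512 and exp 4 <= 256 leave 1 - 1/512 plus half of exp(y^2), of mean at most 2. *)
Lemma subg_center a Z : measurable_fun setT Z -> subg P a Z ->
  subg P (32 * a) (fun w => Z w - Ex P Z).
Proof.
move=> mZ hZ; have [a0 _] := hZ; split; first by lra.
have mean_le : `|Ex P Z / a| <= 2.
  have mZa : measurable_fun setT (fun w => Z w / a) by exact: measurable_funM.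
  have := norm_mean_le mZa (subexp_lin mZ hZ).
  by rewrite Ex_div//; exact: subg_integrable hZ.
apply: (le_trans (_ : _ <= \int[P]_w ((1 - 1 / 512) + (1 / 2 * expR ((Z w / a) ^+ 2) + 0 * expR ((Z w / a) ^+ 2)))%:E)%E).
  apply: ge0_le_integral => //.
  - by apply/measurable_EFinP; apply: measurable_sqr_exp; exact: measurable_funB.
  - apply/measurable_EFinP; apply: measurable_funD => //.
    by apply: measurable_funD; apply: measurable_funM => //; exact: measurable_sqr_exp.
  - move=> w _; rewrite lee_fin mul0r addr0.
    have -> : (Z w - Ex P Z) / (32 * a) = (Z w / a - Ex P Z / a) / 32.
      by field; rewrite lt0r_neq0.
    move: mean_le; move: (Ex P Z / a) (Z w / a) => m y m2.
    have m4 : m ^+ 2 <= 4 by rewrite -(real_normK (num_real m)); have := normr_ge0 m; nra.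
    apply: (@le_trans _ _ (expR (1 / 512 * (y ^+ 2 + 4)))).
      by rewrite ler_expR; have := sqr_ge0 (y + m); nra.
    apply: (le_trans (expR_convex _ _ _)); rewrite ?lerD2l; [lra|lra|].
    have e4 : expR 4 <= 256 :> RR.
      have -> : expR 4 = expR 1 ^+ 4 :> RR by rewrite -expRM_natl mulr1.
      have -> : 256 = 4 ^+ 4 :> RR by rewrite -natrX.
      by rewrite lerXn2r ?nnegrE ?expR_ge0// expR1_le4.
    rewrite exp.expRD; have := expR_gt0 (y ^+ 2); nra.
apply: (le_trans (integral_sqr_exp_comb mZ mZ hZ hZ _ _ _)); rewrite ?lee_fin; lra.
Qed.

(* For n = 0 the supremum is over the empty set: it is -oo, and [fine] gives 0. *)
Lemma fine_psi2_vec_ge0 n (Z : T -> 'cV[RR]_n) : 0 <= fine (psi2_vec P Z).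
Proof.
have [noP|/existsNP[v v1]] := pselect (forall v : 'cV[RR]_n, eucl_norm v <> 1); last first.
  apply: fine_ge0; apply: (@le_trans _ _ (psi2 P (fun w => (v^T *m Z w) 0 0))).
    by apply: le_ereal_inf_tmp => _ [s [s0 _] <-]; rewrite lee_fin ltW.
  by apply: ereal_sup_ubound; exists v => //; apply: contrapT.
rewrite /psi2_vec (_ : [set _ | _ in _] = set0) ?ereal_sup0//.
by apply/seteqP; split => // z [v v1 _]; exact: (noP v v1).
Qed.

Lemma psi2_vec_subg n (Z : T -> 'cV[RR]_n) a v : rvec_measurable Z ->
  (psi2_vec P Z < +oo)%E -> fine (psi2_vec P Z) < a -> eucl_norm v <= 1 ->
  subg P a (fun w => dot v (Z w)).
Proof.
move=> mZ Zoo Za v1; have a0 := le_lt_trans (fine_psi2_vec_ge0 Z) Za.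
have mdot u : measurable_fun setT (fun w => dot u (Z w)).
  have := measurable_dotX 0 u mZ; by under eq_fun do rewrite subr0.
have unit u : eucl_norm u = 1 -> subg P a (fun w => dot u (Z w)).
  move=> u1; apply: psi2_subg => //.
  have : (psi2 P (fun w => dot u (Z w)) <= psi2_vec P Z)%E.
    by apply: ereal_sup_ubound; exists u.
  move=> /le_lt_trans; apply.
  by move: Zoo Za; case: (psi2_vec P Z) => [r _|//|_ _]; rewrite ?lte_fin ?ltNyr.
have [v0|v0] := eqVneq (eucl_norm v) 0.
  rewrite (eucl_norm_eq0 v0); have := subg0 a0.
  congr (subg P a _); apply/funext => w.
  by rewrite dotC dot0r.
set c := eucl_norm v in v1 v0.
have c0 : 0 < c by rewrite lt_def v0 eucl_norm_ge0.
apply: subg_le (unit (c^-1 *: v) _) => //.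
  move=> w; rewrite dotZl !normrM ler_wpM2r// ler_peMl// ger0_norm ?invr_ge0 ?(ltW c0)//.
  by rewrite invf_ge1.
by rewrite eucl_normZ ger0_norm ?invr_ge0 ?(ltW c0)// mulVf.
Qed.

End Psi2.

(** * Moments of sub-Gaussian vectors *)

Lemma dot_delta n (v : 'cV[RR]_n) j : dot (delta_mx j 0) v = v j 0.
Proof.
rewrite dotE (bigD1 j)//= mxE !eqxx mul1r big1 ?addr0// => i /negPf ij.
by rewrite mxE ij mul0r.
Qed.

Lemma eucl_norm_delta n j : eucl_norm (delta_mx j 0 : 'cV[RR]_n) = 1.
Proof.
apply/eqP; rewrite -(eqrXn2 (n := 2))// ?eucl_norm_ge0//.
by rewrite eucl_norm_sqr dot_delta mxE !eqxx expr1n.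
Qed.

Lemma dot_delta_mul n (M : 'M[RR]_n) i : dot (delta_mx i 0) (M *m delta_mx i 0) = M i i.
Proof. by rewrite dot_delta -colE mxE. Qed.

Section Moments.
Context d (T : measurableType d) (P : probability T RR) (D : nat).
Variable X : T -> 'cV[RR]_D.
Hypotheses (mX : rvec_measurable X) (Xoo : (psi2_vec P X < +oo)%E).
Local Notation mu := (mean_vec P X).
Local Notation Sig := (cov_mx P X).

(** The added 1 makes the scale positive and strictly larger than the norm. *)
Let s0 := fine (psi2_vec P X) + 1.

Let s0_gt0 : 0 < s0.
Proof. by have := fine_psi2_vec_ge0 P X; rewrite /s0; lra. Qed.

Let subgX v : eucl_norm v <= 1 -> subg P s0 (fun w => dot v (X w)).
Proof. by apply: psi2_vec_subg => //; rewrite /s0; lra. Qed.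

Lemma measurable_dot_vec v : measurable_fun setT (fun w => dot v (X w)).
Proof. by have := measurable_dotX 0 v mX; under eq_fun do rewrite subr0. Qed.

Let coord_int j : P.-integrable setT (fun w => (X w j 0)%:E).
Proof.
have h : eucl_norm (delta_mx j 0 : 'cV[RR]_D) <= 1 by rewrite eucl_norm_delta.
have := subg_integrable (measurable_dot_vec _) (subgX h).
by under eq_fun do rewrite dot_delta.
Qed.

Lemma dot_mean v : dot v mu = Ex P (fun w => dot v (X w)).
Proof.
have [_ h] := Ex_sum (fun i => v i 0) coord_int.
rewrite dotE; under eq_bigr do rewrite mxE; rewrite -h; congr Ex.
by apply/funext => w; rewrite dotE.
Qed.

Lemma subg_centered v : eucl_norm v <= 1 -> subg P (32 * s0) (fun w => dot v (X w - mu)).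
Proof.
move=> v1; have := subg_center (measurable_dot_vec v) (subgX v1).
congr (subg P _ _); apply/funext => w.
by rewrite dotDr dotNr dot_mean.
Qed.

Lemma subg_centered_scale c v : 0 < c -> eucl_norm v <= c ->
  subg P (c * (32 * s0)) (fun w => dot v (X w - mu)).
Proof.
move=> c0 vc.
have h : eucl_norm (c^-1 *: v) <= 1.
  by rewrite eucl_normZ ger0_norm ?invr_ge0 ?(ltW c0)// ler_pdivrMl// mulr1.
apply: subg_le (subg_centered h).
- exact: measurable_dotX.
- exact: measurable_dotX.
- by rewrite mulr_gt0// mulr_gt0.
- by move=> w; rewrite dotZl invfM mulrCA mulrA.
Qed.

Lemma dot_centered_mean v : Ex P (fun w => dot v (X w - mu)) = 0.
Proof.
have [hi _] := Ex_sum (fun i => v i 0) coord_int.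
have {}hi : P.-integrable setT (fun w => (dot v (X w))%:E).
  by under eq_fun do rewrite dotE.
have E : (\int[P]_w (dot v (X w))%:E = (Ex P (fun w => dot v (X w)))%:E)%E.
  by rewrite fineK//; exact: integrable_fin_num hi.
rewrite [LHS]/Ex; under eq_integral do rewrite dotDr dotNr dot_mean EFinB.
rewrite integralB//; last exact: finite_measure_integrable_cst.
by rewrite [X in fine (X - _)]E [X in fine (_ - X)]integral_prob_cst -EFinB subrr.
Qed.

Lemma dot_cov a b :
  dot a (Sig *m b) = Ex P (fun w => dot a (X w - mu) * dot b (X w - mu)).
Proof.
pose f (p : 'I_D * 'I_D) w := (X w - mu) p.1 0 * (X w - mu) p.2 0.
have fi p : P.-integrable setT (fun w => (f p w)%:E).
  have h j : eucl_norm (delta_mx j 0 : 'cV[RR]_D) <= 1 by rewrite eucl_norm_delta.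
  have := subg_integrableM (measurable_dotX mu _ mX) (measurable_dotX mu _ mX)
    (subg_centered (h p.1)) (subg_centered (h p.2)).
  by under eq_fun do rewrite !dot_delta.
have [_ h] := Ex_sum (fun p => a p.1 0 * b p.2 0) fi.
transitivity (\sum_p a p.1 0 * b p.2 0 * Ex P (f p)).
  rewrite dotE -(pair_bigA _ (fun i j => a i 0 * b j 0 * Ex P (f (i, j))))/=.
  apply: eq_bigr => i _; rewrite mxE mulr_sumr; apply: eq_bigr => j _.
  by rewrite mxE -mulrA; congr (_ * _); rewrite mulrC.
rewrite -h; congr Ex; apply/funext => w.
rewrite -(pair_bigA _ (fun i j => a i 0 * b j 0 * f (i, j) w))/= !dotE mulr_suml.
apply: eq_bigr => i _; rewrite mulr_sumr; apply: eq_bigr => j _.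
by rewrite /f/= mulrACA.
Qed.

Lemma cov_sym : Sig^T = Sig.
Proof.
apply/matrixP => i j; rewrite !mxE; congr Ex; apply/funext => w.
by rewrite mulrC.
Qed.

Lemma cov_psd : psd Sig.
Proof.
split; first exact: cov_sym.
move=> v; rewrite -mulmxA -/(dot _ _) dot_cov fine_ge0// integral_ge0// => w _.
by rewrite lee_fin -expr2 sqr_ge0.
Qed.

Lemma pinv_cov_psd : psd (mp_pinv Sig).
Proof.
split; first by rewrite mp_pinv_sym// cov_sym.
move=> v; have [_ h _ _] := mp_pinvP Sig.
have -> : v^T *m mp_pinv Sig *m v = (mp_pinv Sig *m v)^T *m Sig *m (mp_pinv Sig *m v).
  by rewrite trmx_mul (mp_pinv_sym cov_sym) !mulmxA -(mulmxA v^T (mp_pinv Sig) Sig)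
    -(mulmxA v^T (_ *m Sig) (mp_pinv Sig)) h.
by have [_ ] := cov_psd; apply.
Qed.

Lemma measurable_lin m (M : 'M[RR]_(m, D)) : rvec_measurable (fun w => M *m (X w - mu)).
Proof.
move=> j; have := measurable_dotX mu (row j M)^T mX.
congr measurable_fun; apply/funext => w.
by rewrite /dot trmxK -row_mul mxE.
Qed.

(** [fine] sends +oo to 0; finiteness is what makes the real psi_2 norms of linear images
    meaningful. *)
Lemma psi2_vec_lin_fin m (M : 'M[RR]_(m, D)) :
  (psi2_vec P (fun w => M *m centered P X w) < +oo)%E.
Proof.
have [c c0 Mc] := op_bound_exists M^T.
apply: (@le_lt_trans _ _ (((c + 1) * (32 * s0))%:E)); last exact: ltry.
apply: ge_ereal_sup => _ [v v1 <-]; apply: subg_psi2.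
have := @subg_centered_scale (c + 1) (M^T *m v).
rewrite ltr_wpDl// => /(_ erefl) h.
have {}h : subg P ((c + 1) * (32 * s0)) (fun w => dot (M^T *m v) (X w - mu)).
  by apply: h; rewrite (le_trans (Mc v))// v1 mulr1 lerDl.
move: h; congr (subg P _ _); apply/funext => w.
by rewrite -dot_mulr.
Qed.

Lemma subg_lin m (M : 'M[RR]_(m, D)) al v :
  fine (psi2_vec P (fun w => M *m centered P X w)) < al -> eucl_norm v <= 1 ->
  subg P al (fun w => dot (M^T *m v) (X w - mu)).
Proof.
move=> hal v1; have := psi2_vec_subg (measurable_lin M) (psi2_vec_lin_fin M) hal v1.
by under eq_fun do rewrite dot_mulr.
Qed.

Lemma psi2_vec_var m (M : 'M[RR]_(m, D)) v : eucl_norm v <= 1 ->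
  dot (M^T *m v) (Sig *m (M^T *m v)) <=
    fine (psi2_vec P (fun w => M *m centered P X w)) ^+ 2.
Proof.
move=> v1; set K := fine _.
have K0 : 0 <= K by exact: fine_psi2_vec_ge0.
have h al : K < al -> dot (M^T *m v) (Sig *m (M^T *m v)) <= al ^+ 2.
  move=> Kal; rewrite dot_cov; apply: subg_moment2; first exact: measurable_dotX.
  exact: subg_lin.
set x := dot _ _ in h *.
rewrite leNgt; apply/negP => Kx.
have x0 : 0 <= x by rewrite (le_trans (sqr_ge0 K))// ltW.
have sK : K < Num.sqrt x by rewrite -(ger0_norm K0) -sqrtr_sqr ltr_sqrt// (le_lt_trans (sqr_ge0 K)).
(* The moment bound holds only at scales strictly above [K]; the midpoint of [K] and sqrt x is such
   a scale, yet its square is below x. *)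
have := h ((K + Num.sqrt x) / 2); have := sqr_sqrtr x0.
have := sqrtr_ge0 x; move: (Num.sqrt x) sK => y Ky y0 yx /(_ _) hh.
have : x <= ((K + y) / 2) ^+ 2 by apply: hh; lra.
rewrite -yx; nra.
Qed.

(** Norm 0 makes all variances of A Sigma^+ X vanish; they are the squared column norms of S A^T, so
    A Sigma^+ = (S A^T)^T S = 0. Positivity is what allows twice the norm as a scale. *)
Lemma psi2_pinv_gt0 m (A : 'M[RR]_(m, D)) : A *m mp_pinv Sig != 0 ->
  0 < fine (psi2_vec P (fun w => A *m mp_pinv Sig *m centered P X w)).
Proof.
move=> A0; rewrite lt_def fine_psi2_vec_ge0 andbT; apply: contraNN A0 => /eqP K0.
have [[tS _] SS] := psd_sqrtP pinv_cov_psd; set S := psd_sqrt _ in tS SS.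
have [_ PSP _ _] := mp_pinvP Sig.
suff SA : S *m A^T = 0.
  by rewrite -SS mulmxA -[A *m S]trmxK trmx_mul tS SA trmx0 mul0mx.
apply: gram_eq0 => i; apply/eqP; rewrite eq_le.
have E : ((S *m A^T)^T *m (S *m A^T)) i i = dot ((A *m mp_pinv Sig)^T *m delta_mx i 0)
    (Sig *m ((A *m mp_pinv Sig)^T *m delta_mx i 0)).
  rewrite -dot_delta_mul -dot_mulr; congr dot; rewrite !mulmxA; congr (_ *m _).
  rewrite !trmx_mul trmxK tS (mp_pinv_sym cov_sym) -!mulmxA (mulmxA S S) SS.
  by rewrite (mulmxA Sig) (mulmxA (mp_pinv Sig) _ A^T) (mulmxA (mp_pinv Sig) Sig) PSP.
rewrite E; apply/andP; split.
  have h : eucl_norm (delta_mx i 0 : 'cV[RR]_m) <= 1 by rewrite eucl_norm_delta.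
  by have := psi2_vec_var (A *m mp_pinv Sig) h; rewrite K0 expr0n.
have [_ h] := cov_psd; by rewrite /dot mulmxA.
Qed.

End Moments.

(** * Almost sure support of the sample covariance *)

Section Range.
Context d (T : measurableType d) (P : probability T RR) (D N : nat).
Variables (X : T -> 'cV[RR]_D) (Xs : 'I_N -> T -> 'cV[RR]_D).
Hypotheses (mX : rvec_measurable X) (Xoo : (psi2_vec P X < +oo)%E).
Hypotheses (mXs : forall i, rvec_measurable (Xs i)) (lXs : forall i, same_law P (Xs i) X).
Hypothesis N0 : (0 < N)%N.
Local Notation mu := (mean_vec P X).
Local Notation Sig := (cov_mx P X).
Local Notation Pi := (Sig *m mp_pinv Sig).

Lemma degenerate_as a i : dot a (Sig *m a) = 0 ->
  fails_at_most P 0 (fun w => dot a (Xs i w - mu) = 0).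
Proof.
move=> a0.
have mf := measurable_dot mu a.
have mY := measurable_dotX mu a (mXs i); have mZ := measurable_dotX mu a mX.
have hint : P.-integrable setT (fun w => (dot a (X w - mu) * dot a (X w - mu))%:E).
  have c0 : 0 < eucl_norm a + 1 by have := eucl_norm_ge0 a; lra.
  have ac : eucl_norm a <= eucl_norm a + 1 by lra.
  have sa := subg_centered_scale mX Xoo c0 ac.
  exact: (subg_integrableM mZ mZ sa sa).
have I0 : (\int[P]_w (dot a (Xs i w - mu) ^+ 2)%:E = 0)%E.
  rewrite (same_law_integral (f := fun v => dot a (v - mu) ^+ 2) (mXs i) mX (lXs i)).
  - under eq_integral do rewrite expr2.
    by rewrite -(fineK (integrable_fin_num measurableT hint)) -/(Ex P _) -dot_cov// a0.
  - exact: measurable_funX.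
  - by move=> v; exact: sqr_ge0.
have mY2 : measurable_fun setT (fun w => (dot a (Xs i w - mu) ^+ 2)%:E : \bar RR).
  by apply/measurable_EFinP; exact: measurable_funX.
have /(ae_eq_integral_abs P measurableT mY2) : (\int[P]_w `|(dot a (Xs i w - mu) ^+ 2)%:E| = 0)%E.
  by rewrite -[RHS]I0; apply: eq_integral => w _; rewrite gee0_abs// lee_fin sqr_ge0.
move=> [F [mF PF hF]]; exists F; split => //; first by rewrite PF.
move=> w nF; apply: contrapT => h; apply: nF; apply: hF => /= /(_ I) [] /eqP.
by rewrite sqrf_eq0 => /eqP.
Qed.

Lemma range_as : fails_at_most P 0 (fun w =>
  Pi *m sample_cov (fun i => Xs i w) = sample_cov (fun i => Xs i w)).
Proof.
have PiT := range_proj_tr Sig.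
(* These vectors span the kernel of Sigma: each sample has zero variance along them, and finitely
   many null sets are discarded. *)
pose a j : 'cV[RR]_D := (1%:M - Pi)^T *m delta_mx j 0.
have a0 j : dot (a j) (Sig *m a j) = 0.
  have -> : Sig *m a j = 0.
    rewrite /a linearB/= trmx1 PiT mulmxA mulmxBr mulmx1.
    have -> : Sig *m Pi = Sig.
      have := congr1 trmx (mul_range_proj Sig).
      by rewrite trmx_mul PiT cov_sym.
    by rewrite subrr mul0mx.
  by rewrite dot0r.
have h := @fails_all _ _ P _ (enum {: 'I_N * 'I_D}) 0
  (fun p w => dot (a p.2) (Xs p.1 w - mu) = 0).
apply: fails_le (h _); first by rewrite mulr0.
  move=> w hw; apply/eqP; rewrite eq_sym -subr_eq0 -{1}[sample_cov _]mul1mx -mulmxBl; apply/eqP.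
  apply/matrixP => j k; rewrite [RHS]mxE.
  have -> : ((1%:M - Pi) *m sample_cov (Xs^~ w)) j k = dot (a j) (sample_cov (Xs^~ w) *m delta_mx k 0).
    by rewrite -dot_mulr mulmxA dot_delta -colE [RHS]mxE.
  rewrite (sample_cov_dot N0 _ _ _ mu).
  have h0 i : dot (a j) (Xs i w - mu) = 0 by apply: (hw (i, j)); rewrite mem_enum.
  rewrite big1; last by move=> i _; rewrite h0 mul0r.
  by rewrite [X in _ - _ * X * _]big1 ?mulr0 ?mul0r ?subrr// => i _; exact: h0.
by move=> p _; exact: degenerate_as.
Qed.

End Range.

Section Numeric.

(** The factors to beat are 2^(36 r) pairs of net points, 6 for the scalar bound and 4 for the
    number of events: 24 <= 2^5 <= exp 5, and 36 r + 5 <= 50 r since r >= 1. *)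
Lemma failure_bound (r : nat) (u : RR) : (0 < r)%N -> 0 < u ->
  2 ^+ (36 * r) * (6 * expR (- (50 * (r%:R + u)))) <= 1 / 4 * expR (- u).
Proof.
move=> r0 u0.
have e2 : 2 <= expR 1 :> RR by have := expR_ge1Dx (1 : RR); lra.
have p2 m : 2 ^+ m <= expR m%:R :> RR.
  by rewrite -[m%:R]mulr1 expRM_natl lerXn2r ?nnegrE ?expR_ge0.
have r1 : 1 <= r%:R :> RR by rewrite ler1n.
have h1 := p2 (36 * r)%N; have h2 := p2 5%N.
rewrite natrM in h1.
have h3 : 24 <= expR 5 :> RR by apply: le_trans h2; rewrite !exprS expr0; lra.
have h4 : expR (36 * r%:R) * (expR 5 * expR (- (50 * (r%:R + u)))) <= expR (- u).
  by rewrite -!exp.expRD ler_expR; lra.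
have h5 : 2 ^+ (36 * r) * (24 * expR (- (50 * (r%:R + u)))) <= expR (- u).
  apply: le_trans h4; rewrite ler_pM ?exprn_ge0 ?mulr_ge0 ?expR_ge0//.
  by rewrite ler_wpM2r ?expR_ge0.
lra.
Qed.

Lemma fails_event d (T : measurableType d) (P : probability T RR) p (Q : T -> Prop) :
  fails_at_most P p Q ->
  exists E, measurable E /\ E `<=` [set w | Q w] /\ ((1 - p)%:E <= P E)%E.
Proof.
move=> [F [mF PF hF]]; exists (~` F); split; first exact: measurableC.
split; first by move=> w /hF.
by rewrite probability_setC// EFinB leeB.
Qed.

End Numeric.

(** * The main bound *)

Section Main.
Context d (T : measurableType d) (P : probability T RR) (D N : nat).
Variables (X : T -> 'cV[RR]_D) (Xs : 'I_N -> T -> 'cV[RR]_D).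
Hypotheses (mX : rvec_measurable X) (Xoo : (psi2_vec P X < +oo)%E).
Hypotheses (mXs : forall i, rvec_measurable (Xs i)) (lXs : forall i, same_law P (Xs i) X).
Hypothesis iXs : mutually_independent P Xs.
Hypothesis N0 : (0 < N)%N.
Local Notation Sig := (cov_mx P X).
Local Notation psin M := (fine (psi2_vec P (fun w => M *m centered P X w))).
Local Notation S := (psd_sqrt (mp_pinv Sig)).

(** The whitened vector has covariance [Pi], hence variance 1 along a unit vector of the range, and
    a variance is at most the squared psi_2 norm. *)
Lemma psi2_whitened_ge1 : Sig != 0 -> 1 <= psin S.
Proof.
move=> Sig0; have [[tS _] SS] := psd_sqrtP (pinv_cov_psd mX Xoo).
have tSig := cov_sym P X.
pose Pi := Sig *m mp_pinv Sig.
have [j hj] : exists j, Pi *m delta_mx j 0 != 0 :> 'cV[RR]_D.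
  apply: contrapT => /forallNP h; move/eqP: Sig0; apply.
  rewrite -[LHS](mul_range_proj Sig) (_ : _ *m mp_pinv Sig = 0) ?mul0mx//.
  apply/matrixP => i k; have /negP := h k; rewrite negbK => /eqP /colP /(_ i).
  by rewrite -colE [LHS]mxE => ->; rewrite !mxE.
set v := Pi *m _ in hj.
have c0 : 0 < eucl_norm v.
  by rewrite lt_def eucl_norm_ge0 andbT; apply: contraNN hj => /eqP /eucl_norm_eq0 ->.
pose u := (eucl_norm v)^-1 *: v.
have u1 : eucl_norm u = 1.
  by rewrite eucl_normZ ger0_norm ?invr_ge0 ?(ltW c0)// mulVf// lt0r_neq0.
have Piu : Pi *m u = u.
  by rewrite /u -scalemxAr /v mulmxA range_proj_idem.
have u1' : eucl_norm u <= 1 by rewrite u1.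
have := psi2_vec_var mX Xoo S u1'.
have -> : dot (S^T *m u) (Sig *m (S^T *m u)) = 1.
  rewrite -dot_mulr tS !mulmxA (sqrt_whitens tSig tS SS) -/Pi Piu.
  by rewrite -eucl_norm_sqr u1 expr1n.
by have := fine_psi2_vec_ge0 P (fun w => S *m centered P X w); nra.
Qed.

(** 64 = 2 * 2 * 2 * 8: the net argument, the doubling of each of the two psi_2 scales, and sqrt 50
    <= 8. *)
Lemma pert_const_subproof : {c : RR | c = 64 * cov_const}.
Proof. by exists (64 * cov_const). Qed.

Definition pert_const : RR := sval pert_const_subproof.

Lemma pert_constE : pert_const = 64 * cov_const.
Proof. exact: (svalP pert_const_subproof). Qed.

Lemma pert_const_gt0 : 0 < pert_const.
Proof. by have := cov_const_gt0; rewrite pert_constE; lra. Qed.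

Lemma op_bound_concentration m1 m2 (M1 : 'M[RR]_(m1, D)) (M2 : 'M[RR]_(m2, D)) (r : nat) u :
  (0 < r)%N -> 0 < u -> 50 * (r%:R + u) <= N%:R ->
  (\rank M1 <= r)%N -> (\rank M2 <= r)%N -> 0 < psin M1 -> 0 < psin M2 ->
  fails_at_most P (1 / 4 * expR (- u)) (fun w =>
    op_bound (M1 *m (sample_cov (fun i => Xs i w) - Sig) *m M2^T)
      (pert_const * (psin M1 * psin M2 * Num.sqrt ((r%:R + u) / N%:R)))).
Proof.
move=> r0 u0 tN rM1 rM2 K1 K2.
have r1 : 1 <= r%:R :> RR by rewrite ler1n.
have t0 : 0 < 50 * (r%:R + u) by lra.
have d1 : psin M1 < 2 * psin M1 by lra.
have d2 : psin M2 < 2 * psin M2 by lra.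
have p1 : 0 < 2 * psin M1 by lra.
have p2 : 0 < 2 * psin M2 by lra.
have := cov_op_bound mX mXs lXs iXs N0 (dot_centered_mean mX Xoo) (dot_cov mX Xoo)
  rM1 rM2 r0 p1 p2 (fun v => subg_lin mX Xoo d1 (v := v)) (fun v => subg_lin mX Xoo d2 (v := v)) t0 tN.
apply: fails_le; first exact: failure_bound.
move=> w; apply: op_bound_le.
have Nr : 0 < N%:R :> RR by rewrite ltr0n.
have s8 : Num.sqrt (50 * (r%:R + u) / N%:R) <= 8 * Num.sqrt ((r%:R + u) / N%:R).
  have -> : 8 * Num.sqrt ((r%:R + u) / N%:R) = Num.sqrt (8 ^+ 2 * ((r%:R + u) / N%:R)) :> RR.
    by rewrite [RHS]sqrtrM ?sqr_ge0// sqrtr_sqr ger0_norm.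
  apply: ler_wsqrtr; rewrite -mulrA ler_wpM2r//; first by rewrite divr_ge0 ?ltW//; lra.
  by rewrite expr2; lra.
set x := Num.sqrt (50 * _ / _) in s8 *; set y := Num.sqrt _ in s8 *.
set a := psin M1 in K1 *; set b := psin M2 in K2 *.
rewrite pert_constE; have c0 := cov_const_gt0; move: cov_const c0 => c c0.
have -> : 2 * c * (2 * a * (2 * b)) * x = (8 * (c * a * b)) * x by ring.
have -> : 64 * c * (a * b * y) = (8 * (c * a * b)) * (8 * y) by ring.
by rewrite ler_wpM2l// mulr_ge0// !mulr_ge0// ltW.
Qed.

Lemma main_bound d1 d2 (A : 'M[RR]_(d1, D)) (B : 'M[RR]_(d2, D)) (r : nat) u :
  0 < u -> r = \rank Sig ->
  (4 * pert_const ^+ 2 + 50) * (r%:R + u) * psin S ^+ 4 < N%:R ->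
  fails_at_most P (expR (- u)) (fun w =>
    spec_norm (A *m (mp_pinv (sample_cov (fun i => Xs i w)) - mp_pinv Sig) *m B^T)
      <= 2 * pert_const * psin (A *m mp_pinv Sig) * psin (B *m mp_pinv Sig)
         * Num.sqrt ((r%:R + u) / N%:R)).
Proof.
move=> u0 rE hN.
have tSig := cov_sym P X.
have kp := pert_const_gt0.
have [[tS _] SS] := psd_sqrtP (pinv_cov_psd mX Xoo).
have KA0 := fine_psi2_vec_ge0 P (fun w => A *m mp_pinv Sig *m centered P X w).
have KB0 := fine_psi2_vec_ge0 P (fun w => B *m mp_pinv Sig *m centered P X w).
have q0 := sqrtr_ge0 ((r%:R + u) / N%:R : RR).
have e0 := expR_gt0 (- u).
have tSh w : (sample_cov (fun i => Xs i w))^T = sample_cov (fun i => Xs i w).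
  rewrite /sample_cov linearZ/= linear_sum/=; congr (_ *: _).
  by apply: eq_bigr => i _; rewrite trmx_mul trmxK.
have as_range := range_as mX Xoo mXs lXs N0.
have rhs0 : 0 <= 2 * pert_const * psin (A *m mp_pinv Sig) * psin (B *m mp_pinv Sig)
         * Num.sqrt ((r%:R + u) / N%:R).
  by rewrite mulr_ge0// mulr_ge0// mulr_ge0// mulr_ge0// ltW.
(* When A Sigma^+ or B Sigma^+ is 0 the right-hand side vanishes, so the left-hand
   side has to vanish almost surely. *)
have [degen|] := pselect (A *m mp_pinv Sig = 0 \/ B *m mp_pinv Sig = 0).
  apply: fails_le as_range; first exact: ltW.
  move=> w hw; apply: le_trans rhs0.
  by rewrite (pinv_degenerate tSig (tSh w) hw degen) spec_norm0.
move=> /not_orP[/eqP A0 /eqP B0].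
have KA := psi2_pinv_gt0 mX Xoo A0; have KB := psi2_pinv_gt0 mX Xoo B0.
(* The non-degenerate case also excludes rank 0, for which neither the nets nor the lower bound on
   the whitened norm is available. *)
have Sig0 : Sig != 0.
  apply: contraNN A0 => /eqP E; have [_ h _ _] := mp_pinvP Sig.
  by rewrite -h E mulmx0 mul0mx mulmx0.
have r0 : (0 < r)%N by rewrite rE lt0n mxrank_eq0.
have r1 : 1 <= r%:R :> RR by rewrite ler1n.
have K1 := psi2_whitened_ge1 Sig0.
have Nr : 0 < N%:R :> RR by rewrite ltr0n.
set x := r%:R + u in hN q0 *.
have x0 : 0 < x by rewrite /x; lra.
set K := psin S in hN K1.
have K0 : 0 <= K by lra.
have K4 : 1 <= K ^+ 4 by rewrite exprn_ege1.
have tN : 50 * x <= N%:R.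
  apply: ltW; apply: le_lt_trans hN.
  rewrite -[leLHS]mulr1 ler_pM//; first by lra.
  by rewrite ler_wpM2r ?(ltW x0)// lerDr mulr_ge0 ?sqr_ge0.
have rP m (M : 'M[RR]_(m, D)) : (\rank (M *m mp_pinv Sig) <= r)%N.
  have [_ h _ _] := mp_pinvP Sig.
  rewrite rE -h !mulmxA -(mulmxA _ Sig); apply: leq_trans (mxrankM_maxr _ _) _.
  exact: mxrankM_maxl.
have rS : (\rank S <= r)%N by rewrite rE -(range_proj_mul_sqrt tS SS) -mulmxA mxrankM_maxl.
have KS : 0 < psin S by rewrite -/K; lra.
have cAB := op_bound_concentration r0 u0 tN (rP _ A) (rP _ B) KA KB.
have cAS := op_bound_concentration r0 u0 tN (rP _ A) rS KA KS.
have cSB := op_bound_concentration r0 u0 tN rS (rP _ B) KS KB.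
have cSS := op_bound_concentration r0 u0 tN rS rS KS KS.
apply: fails_le (fails_and as_range (fails_and cAB (fails_and cAS (fails_and cSB cSS)))).
  by move: e0; move: (expR _) => e e0; lra.
move=> w [hw [hAB [hAS [hSB hSS]]]].
rewrite -/K -/x in hAB hAS hSB hSS *; rewrite !tS in hAS hSS.
set q := Num.sqrt _ in q0 hAB hAS hSB hSS *.
have q2 : q ^+ 2 = x / N%:R by rewrite sqr_sqrtr// divr_ge0 ?ltW.
(* Here the part 4 c^2 of the constant on N is spent, with c = [pert_const]: the square of the left
   side is c^2 x K^4 / N. The part 50 went into [tN]. *)
have key : pert_const * (K * K * q) <= 1 / 2.
  rewrite -ler_sqr ?nnegrE; last 2 first.
  - by rewrite !mulr_ge0 ?(ltW kp).
  - by [].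
  have -> : (pert_const * (K * K * q)) ^+ 2 = (pert_const ^+ 2 * x * K ^+ 4) / N%:R.
    by rewrite !exprMn q2; ring.
  rewrite ler_pdivrMr//.
  have h0 : 0 < x * K ^+ 4 by rewrite mulr_gt0// (lt_le_trans ltr01).
  have h1 : (4 * pert_const ^+ 2 + 50) * x * K ^+ 4 =
    4 * (pert_const ^+ 2 * x * K ^+ 4) + 50 * (x * K ^+ 4) by ring.
  have h2 : (1 / 2) ^+ 2 = 1 / 4 :> RR by rewrite expr2; lra.
  by rewrite h2; move: hN; rewrite h1; lra.
set a := psin (A *m _) in KA hAB hAS *; set b := psin (B *m _) in KB hAB hSB *.
have y0 : 0 <= pert_const * (a * K * q).
  by rewrite !mulr_ge0 ?(ltW kp) ?(ltW KA) ?(ltW KB).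
have z0 : 0 <= pert_const * (K * b * q).
  by rewrite !mulr_ge0 ?(ltW kp) ?(ltW KA) ?(ltW KB).
apply: spec_norm_le => //.
apply: op_bound_le (pinv_perturbation tSig tS SS (tSh w) hw (op_bound_le key hSS) y0 z0 hAB hAS hSB).
(* The two factors K of the quadratic term combine with one q into the quantity bounded by [key], so
   this term at most doubles the linear one. *)
have -> : pert_const * (a * b * q) + 2 * (pert_const * (a * K * q)) * (pert_const * (K * b * q)) =
  pert_const * (a * b * q) * (1 + 2 * (pert_const * (K * K * q))) by ring.
have -> : 2 * pert_const * a * b * q = pert_const * (a * b * q) * 2 by ring.
rewrite ler_wpM2l//; last by lra.
by rewrite !mulr_ge0 ?(ltW kp) ?(ltW KA) ?(ltW KB).
Qed.

End Main.
Theorem theorem1 :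
  exists C : RR, 0 < C /\ exists C' : RR, 0 < C' /\
  forall (d : measure_display) (T : measurableType d) (P : probability T RR)
    (D d1 d2 N : nat) (X : T -> 'cV[RR]_D) (Xs : 'I_N -> T -> 'cV[RR]_D)
    (A : 'M[RR]_(d1, D)) (B : 'M[RR]_(d2, D)) (u : RR),
    rvec_measurable X ->
    (psi2_vec P X < +oo)%E ->
    (forall i, rvec_measurable (Xs i)) ->
    (forall i, same_law P (Xs i) X) ->
    mutually_independent P Xs ->
    0 < u ->
    let Sigma := cov_mx P X in
    let Xc := centered P X in
    let r := (\rank Sigma)%:R : RR in
    C * (r + u) * (fine (psi2_vec P (fun w => psd_sqrt (mp_pinv Sigma) *m Xc w))) ^+ 4
      < N%:R ->
    exists E : set T, measurable E /\
      (E `<=` [set w | spec_norm (A *m (mp_pinv (sample_cov (fun i => Xs i w))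
                                          - mp_pinv Sigma) *m B^T)
           <= C' * fine (psi2_vec P (fun w' => A *m mp_pinv Sigma *m Xc w'))
                 * fine (psi2_vec P (fun w' => B *m mp_pinv Sigma *m Xc w'))
                 * Num.sqrt ((r + u) / N%:R)]) /\
      ((1 - expR (- u))%:E <= P E)%E.
Proof.
have kp := pert_const_gt0.
exists (4 * pert_const ^+ 2 + 50); split.
  by have := sqr_ge0 pert_const; lra.
exists (2 * pert_const); split; first by lra.
move=> d T P D d1 d2 N X Xs A B u mX Xoo mXs lXs iXs u0 /= hN.
have N0 : (0 < N)%N.
  rewrite -(ltr_nat RR); apply: le_lt_trans hN.
  rewrite mulr_ge0 ?exprn_ge0 ?fine_psi2_vec_ge0// mulr_ge0//.
    by have := sqr_ge0 pert_const; lra.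
  by rewrite addr_ge0// ltW.
exact: fails_event (main_bound mX Xoo mXs lXs iXs N0 A B u0 erefl hN).
Qed.
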